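(* Let $(H,K)$ be a generalized strong Shoda pair of a finite group $G$, $\lambda$ a linear character of $H$ with kernel $K$, and $H=H_0\le H_1\le\cdots\le H_n=G$ a strong inductive chain from $H$ to $G$. For $0\le i\le n-1$ let $T_i=\{t_{(i,1)},\dots,t_{(i,k_i)}\}$ be a right transversal of $C_i$ in $H_{i+1}$ with $t_{(i,1)}=1$, and let $T=T_0T_1\cdots T_{n-1}=\{t_{(0,s_0)}t_{(1,s_1)}\cdots t_{(n-1,s_{n-1})}\mid 1\le s_i\le k_i\}$. Suppose that the Schur index of $\mathbb{Q}Ge_{\mathbb{Q}}(\lambda^G)$ is $1$. Let $w$ be a normal element of $\mathbb{E}/\mathbb{F}$, let $\mathcal{G}=\operatorname{Gal}(\mathbb{E}/\mathbb{F})=\{\sigma_1,\dots,\sigma_{\mathtt{k}}\}$ with $\sigma_1$ the identity, and let $\mathbf{z}_1,\dots,\mathbf{z}_{\mathtt{k}}$ be units of $\operatorname{Cen}_{\mathcal{A}}(\mathcal{B})$, forming a basis of $\operatorname{Cen}_{\mathcal{A}}(\mathcal{B})$ as a vector space over $\mathbb{E}$, with the following properties (such units exist because the Schur index is $1$): there are $\alpha_1,\dots,\alpha_{\mathtt{k}}\in\mathbb{E}$ with $$\sum_{i=1}^{\mathtt{k}}\alpha_i\sigma_i(w)=\sum_{i=1}^{\mathtt{k}}\sigma_i(w),\qquad \sum_{i=1}^{\mathtt{k}}\alpha_i\sigma_i(\sigma_j(w))=w-\sigma_j(w)\quad(2\le j\le\mathtt{k}),$$ the element $\alpha=\sum_{i=1}^{\mathtt{k}}\alpha_i\mathbf{z}_i$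 is invertible, and, with $\widehat{E}=\frac{1}{\mathtt{k}}\sum_{i=1}^{\mathtt{k}}\mathbf{z}_i$, the set $\{\mathbf{z}_i^{-1}\alpha^{-1}\widehat{E}\alpha\mathbf{z}_i\mid 1\le i\le\mathtt{k}\}$ is a complete set of orthogonal primitive idempotents of $\operatorname{Cen}_{\mathcal{A}}(\mathcal{B})$. Then $$\{t^{-1}\mathbf{z}_i^{-1}\alpha^{-1}\widehat{E}\,\varepsilon(H,K)\,\alpha\,\mathbf{z}_i\,t\mid t\in T,\ 1\le i\le\mathtt{k}\}$$ is a complete set of orthogonal primitive idempotents of $\mathbb{Q}Ge_{\mathbb{Q}}(\lambda^G)$.
   Context: All groups are finite and all characters are complex. For $g\in G$ and $\alpha\in\mathbb{Q}G$, $\alpha^g=g^{-1}\alpha g$. For an irreducible character $\chi$ of a finite group $X$, $e_{\mathbb{Q}}(\chi)=\frac{\chi(1)}{|X|}\sum_{\sigma\in\operatorname{Gal}(\mathbb{Q}(\chi)/\mathbb{Q})}\sum_{g\in X}\sigma(\chi(g))g^{-1}$, a primitive central idempotent of $\mathbb{Q}X$. Shoda pairs. A pair $(H,K)$ of subgroups of $G$ is a Shoda pair if (i) $K\unlhd H$ and $H/K$ is cyclic; (ii) if $g\in G$ and $[H,g]\cap H\subseteq K$ then $g\in H$, where $[H,g]=\langle g^{-1}h^{-1}gh\mid h\in H\rangle$. Then for every linear character $\lambda$ of $H$ with kernel $K$, the induced character $\lambda^G$ is irreducible. For a subgroup $X$, $\widehat{X}=\frac1{|X|}\sum_{x\in X}x$;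 $\varepsilon(H,K)=\widehat{K}$ if $H=K$, and otherwise $\varepsilon(H,K)=\prod_L(\widehat{K}-\widehat{L})$, $L$ running over the normal subgroups of $H$ minimal with respect to properly containing $K$; one has $e_{\mathbb{Q}}(\lambda)=\varepsilon(H,K)$. A Shoda pair $(H,K)$ is a generalized strong Shoda pair if there is a chain $H=H_0\le H_1\le\cdots\le H_n=G$ (a strong inductive chain from $H$ to $G$) such that for all $0\le i\le n-1$: $H_i\unlhd\operatorname{Cen}_{H_{i+1}}(e_{\mathbb{Q}}(\lambda^{H_i}))$, and the distinct $H_{i+1}$-conjugates of $e_{\mathbb{Q}}(\lambda^{H_i})$ are mutually orthogonal. Notation attached to $(H,K)$, $\lambda$ and the chain. Write $e_i=e_{\mathbb{Q}}(\lambda^{H_i})$. $C_i=\operatorname{Cen}_{H_{i+1}}(e_i)$, $k_i=[H_{i+1}:C_i]$, $k=k_0\cdots k_{n-1}$, $\mathtt{k}=\prod_{i=0}^{n-1}|C_i/H_i|=[G:H]/k$. A right transversal $T_i$ of $C_i$ in $H_{i+1}$ is a set of representatives of the cosets $C_it$; it contains $t_{(i,1)}=1$. The map $\theta_i:\mathbb{Q}H_{i+1}e_{i+1}\to M_{k_i}(\mathbb{Q}C_ie_i)$ sending $\beta$ to the matrix whose (row $l$, column $m$) entry is $e_it_{(i,l)}\beta t_{(i,m)}^{-1}e_i$ is an isomorphism of algebras, and $\mathbb{Q}C_ie_i\supseteq\mathbb{Q}H_ie_i$ (it is a crossed product of $C_i/H_i$ over $\mathbb{Q}H_ie_i$). Put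 $\mathcal{A}=\mathbb{Q}Ge_{\mathbb{Q}}(\lambda^G)$, identified through $\theta_{n-1},\dots,\theta_0$ with the iterated matrix/crossed product algebra over $E=\mathbb{Q}He_{\mathbb{Q}}(\lambda)=\mathbb{Q}H\varepsilon(H,K)$ (a field isomorphic to $\mathbb{Q}(\zeta_{[H:K]})$). Starting from $M_0=E$ and $M_{i+1}=\theta_i^{-1}(M_{k_i}(M_i))\subseteq\mathbb{Q}H_{i+1}e_{i+1}$, one obtains the subalgebra $M_n\subseteq\mathcal{A}$, identified by nested blocks with $M_k(E)$. Inside $M_k(E)\subseteq\mathcal{A}$: $\mathbb{E}=\{\operatorname{diag}(\beta,\dots,\beta)\mid\beta\in E\}$, $\mathbb{F}=\mathcal{Z}(\mathcal{A})$ (which is contained in $\mathbb{E}$), $F=\{\beta\in E\mid\operatorname{diag}(\beta,\dots,\beta)\in\mathbb{F}\}$, $\mathcal{B}=M_k(F)$, and $\operatorname{Cen}_{\mathcal{A}}(\mathcal{B})$ is the centralizer of $\mathcal{B}$ in $\mathcal{A}$. It is known that $\mathbb{E}/\mathbb{F}$ is Galois of degree $\mathtt{k}$, that $\operatorname{Cen}_{\mathcal{A}}(\mathcal{B})$ has dimension $\mathtt{k}^2$ over $\mathbb{F}$ and contains $\mathbb{E}$ as a maximal subfield, and that $\mathcal{A}\cong\mathcal{B}\otimes_{\mathbb{F}}\operatorname{Cen}_{\mathcal{A}}(\mathcal{B})$ via multiplication. Inverses in $\operatorname{Cen}_{\mathcal{A}}(\mathcal{B})$ are taken with respect to the identity $e_{\mathbb{Q}}(\lambda^G)$.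 A normal element of a finite Galois extension $L/M$ is $w\in L$ such that $\{\sigma(w)\mid\sigma\in\operatorname{Gal}(L/M)\}$ is an $M$-basis of $L$. The Schur index of a central simple algebra $\cong M_m(D)$ ($D$ a division algebra) is the square root of the dimension of $D$ over its center. A complete set of orthogonal primitive idempotents of a semisimple ring is a finite family of non-zero, pairwise orthogonal idempotents with sum $1$, none of which is a sum of two non-zero orthogonal idempotents. *)

(* Defs.v *)
From HB Require Import structures.
From mathcomp Require Import all_boot all_order all_fingroup all_algebra.
From mathcomp Require Import all_solvable all_field all_character.

Set Implicit Arguments.
Unset Strict Implicit.
Unset Printing Implicit Defensive.

Import Order.TTheory GroupScope GRing.Theory Num.Theory.
Local Open Scope ring_scope.

(* Functions gT -> rat with the convolution product.  An arbitrary group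
   G : {group gT} is allowed below; its group algebra is the subspace
   [QG G] of [galg gT] spanned by G. *)
Definition galg (gT : finGroupType) : Type := {ffun gT -> rat^o}.

Section GroupAlgebra.

Variable gT : finGroupType.

HB.instance Definition _ := Vector.copy (galg gT) {ffun gT -> rat^o}.

Definition gdelta (x : gT) : galg gT := [ffun y => (y == x)%:R].

Definition galg_mul (a b : galg gT) : galg gT :=
  [ffun x => \sum_(y : gT) a y * b (y^-1 * x)%g].

Fact galg_mulA : associative galg_mul.
Proof.
move=> a b c; apply/ffunP=> x; rewrite !ffunE.
under eq_bigr => y _ do rewrite ffunE mulr_sumr.
under [RHS]eq_bigr => y _ do rewrite ffunE mulr_suml.
rewrite [RHS]exchange_big /=; apply: eq_bigr => y _.
rewrite (reindex (fun z : gT => (y^-1 * z)%g)) /=; last first.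
  by exists (fun z : gT => (y * z)%g) => z _; rewrite ?mulKg ?mulKVg.
apply: eq_bigr => z _; rewrite invMg invgK mulgA mulrA.
by rewrite -(mulgA z^-1%g) mulgV mulg1.
Qed.

Fact galg_mul1l : left_id (gdelta 1) galg_mul.
Proof.
move=> a; apply/ffunP=> x; rewrite ffunE (bigD1 1%g) //= big1 => [|y /negPf y1].
  by rewrite ffunE eqxx mul1r invg1 mul1g addr0.
by rewrite ffunE y1 mul0r.
Qed.

Fact galg_mul1r : right_id (gdelta 1) galg_mul.
Proof.
move=> a; apply/ffunP=> x; rewrite ffunE (bigD1 x) //= big1 => [|y /negPf yx].
  by rewrite ffunE mulVg eqxx mulr1 addr0.
by rewrite ffunE -eq_mulVg1 yx mulr0.
Qed.

Fact galg_mulDl : left_distributive galg_mul +%R.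
Proof.
move=> a b c; apply/ffunP=> x; rewrite !ffunE -big_split /=.
by apply: eq_bigr => y _; rewrite ffunE mulrDl.
Qed.

Fact galg_mulDr : right_distributive galg_mul +%R.
Proof.
move=> a b c; apply/ffunP=> x; rewrite !ffunE -big_split /=.
by apply: eq_bigr => y _; rewrite ffunE mulrDr.
Qed.

Fact galg_1_neq0 : gdelta 1 != 0.
Proof. by apply/eqP=> /ffunP/(_ 1%g)/eqP; rewrite !ffunE eqxx. Qed.

HB.instance Definition _ := GRing.Zmodule_isNzRing.Build (galg gT)
  galg_mulA galg_mul1l galg_mul1r galg_mulDl galg_mulDr galg_1_neq0.

Fact galg_scaleAl (q : rat) (a b : galg gT) : q *: (a * b) = q *: a * b.
Proof.
apply/ffunP=> x; rewrite !ffunE scaler_sumr; apply: eq_bigr => y _.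
by rewrite ffunE scalerAl.
Qed.

HB.instance Definition _ :=
  GRing.Lmodule_isLalgebra.Build rat (galg gT) galg_scaleAl.

Fact galg_scaleAr (q : rat) (a b : galg gT) : q *: (a * b) = a * (q *: b).
Proof.
apply/ffunP=> x; rewrite !ffunE scaler_sumr; apply: eq_bigr => y _.
by rewrite ffunE scalerAr.
Qed.

HB.instance Definition _ :=
  GRing.Lalgebra_isAlgebra.Build rat (galg gT) galg_scaleAr.

HB.instance Definition _ := Algebra_isFalgebra.Build rat (galg gT).

Definition QG (X : {set gT}) : {vspace galg gT} :=
  <<[seq gdelta x | x <- enum X]>>%VS.

Definition QGe (X : {set gT}) (e : galg gT) : {vspace galg gT} :=
  (QG X * <[e]>)%VS.

Definition gconj (a : galg gT) (g : gT) : galg gT :=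
  gdelta g^-1 * a * gdelta g.

Definition gcent (X : {set gT}) (a : galg gT) : {set gT} :=
  [set g in X | gconj a g == a].

Definition ghat (X : {set gT}) : galg gT :=
  (#|X|%:R)^-1 *: \sum_(x in X) gdelta x.

Definition geps (H K : {group gT}) : galg gT :=
  if H == K then ghat K else
  \prod_(L : {group gT} | [min L | (K \proper L) && (L <| H)])
    (ghat K - ghat L).

(* [QnT] is a copy of the cyclotomic field Q(zeta_#|gT|), with an embedding
   [QnC] into the complex numbers; it contains all character values of all
   subgroups of gT. *)
Definition QnT : splittingFieldType rat :=
  tag2 (group_num_field_exists [set: gT]).

Definition QnC : {rmorphism QnT -> algC} :=
  tag2 (tagged2' (group_num_field_exists [set: gT])).

Fact char_value_subproof (X : {group gT}) (chi : 'CF(X)) (x : gT) :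
  chi \is a character -> exists a : QnT, QnC a == chi x.
Proof.
move=> Nchi; rewrite /QnC.
case: (tagged2' _) => /= f _ [w _ /(_ gT X chi Nchi x)].
by case=> [|a fa]; [apply: order_dvdG (in_setT x) | exists a; apply/eqP].
Qed.

(* The value chi x, as an element of [QnT]; 0 if chi is not a character. *)
Definition char_value (X : {group gT}) (chi : 'CF(X)) (x : gT) : QnT :=
  if @idP (chi \is a character) is ReflectT Nchi
  then xchoose (char_value_subproof x Nchi) else 0.

Definition char_field (X : {group gT}) (chi : 'CF(X)) : {subfield QnT} :=
  <<1 & [seq char_value chi x | x <- enum X]>>%AS.

(* The coefficients chi(1)/#|X| * \sum_sigma sigma (chi g) are rational, as
   traces from Q(chi) to Q; [getCrat] reads them off as elements of [rat]. *)
Definition eQ (X : {group gT}) (chi : 'CF(X)) : galg gT :=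
  \sum_(g in X)
    getCrat (chi 1%g / #|X|%:R *
             \sum_(s in 'Gal(char_field chi / 1)) QnC (s (char_value chi g)))
      *: gdelta g^-1.

Definition Shoda_pair (G H K : {group gT}) : Prop :=
  [/\ H \subset G, K <| H, cyclic (H / K)
    & forall g, g \in G ->
        <<[set [~ g, h] | h in H]>> :&: H \subset K -> g \in H].

Definition strong_inductive_chain (G H : {group gT}) (lambda : 'CF(H))
    (n : nat) (Hs : nat -> {group gT}) : Prop :=
  [/\ Hs 0%N = H, Hs n = G
    & forall i, (i < n)%N ->
      let e := eQ ('Ind[Hs i] lambda) in
      [/\ Hs i \subset Hs i.+1,
          Hs i <| gcent (Hs i.+1) e
        & {in Hs i.+1 &, forall x y,
            gconj e x != gconj e y -> gconj e x * gconj e y = 0}]].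

(* lambda is any linear character of H with kernel K; a different choice does
   not change the idempotents e_Q(lambda^(H_i)). *)
Definition gen_strong_Shoda_pair (G H K : {group gT}) (lambda : 'CF(H)) :
    Prop :=
  Shoda_pair G H K /\
  exists n Hs, strong_inductive_chain G lambda n Hs.

End GroupAlgebra.

Section Relative.

Variable gT : finGroupType.

Definition left_basis (S V : galg gT -> Prop) (m : nat)
    (v : 'I_m -> galg gT) : Prop :=
  [/\ forall i, V (v i),
      forall x, V x -> exists a : 'I_m -> galg gT,
        (forall i, S (a i)) /\ x = \sum_i a i * v i
    & forall a : 'I_m -> galg gT, (forall i, S (a i)) ->
        \sum_i a i * v i = 0 -> forall i, a i = 0].

Definition inverse_in (R : galg gT -> Prop) (e x y : galg gT) : Prop :=
  [/\ R x, R y, x * y = e & y * x = e].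

(* The automorphisms of the field L fixing M pointwise, as functions of which
   only the restriction to L matters. *)
Definition Gal_elt (L M : galg gT -> Prop) (s : galg gT -> galg gT) : Prop :=
  [/\ forall x, L x -> L (s x),
      forall x y, L x -> L y -> s (x + y) = s x + s y,
      forall x y, L x -> L y -> s (x * y) = s x * s y,
      forall x, M x -> s x = x
    & (forall x y, L x -> L y -> s x = s y -> x = y) /\
      (forall y, L y -> exists2 x, L x & s x = y)].

Definition Gal_enum (L M : galg gT -> Prop) (m : nat)
    (sigma : 'I_m -> galg gT -> galg gT) : Prop :=
  [/\ forall i, Gal_elt L M (sigma i),
      forall i j, (forall x, L x -> sigma i x = sigma j x) -> i = j
    & forall s, Gal_elt L M s ->
        exists i, forall x, L x -> s x = sigma i x].

Definition normal_element (L M : galg gT -> Prop) (m : nat)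
    (sigma : 'I_m -> galg gT -> galg gT) (w : galg gT) : Prop :=
  L w /\ left_basis M L (fun i => sigma i w).

Definition orthogonal_idempotents (R : galg gT -> Prop) (a b : galg gT) :
    Prop :=
  [/\ R a, R b, a * a = a, b * b = b & a * b = 0 /\ b * a = 0].

Definition primitive_idempotent (R : galg gT -> Prop) (f : galg gT) : Prop :=
  [/\ R f, f != 0, f * f = f
    & forall a b, orthogonal_idempotents R a b -> a != 0 -> b != 0 ->
        f <> a + b].

(* The set is an indexed family: distinct indices must give orthogonal, hence
   distinct, members. *)
Definition complete_orthogonal_primitive (R : galg gT -> Prop) (e : galg gT)
    (I : finType) (P : pred I) (f : I -> galg gT) : Prop :=
  [/\ forall i, P i -> primitive_idempotent R (f i),
      forall i j, P i -> P j -> i != j -> f i * f j = 0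
    & \sum_(i | P i) f i = e].

(* The ring A with identity e is isomorphic, via phi^-1, to the ring of
   matrices of size m.+1 over a division algebra D with dim_Z(D) D = r ^ 2. *)
Definition has_Schur_index (A : galg gT -> Prop) (e : galg gT) (r : nat) :
    Prop :=
  exists (D : falgType rat) (m : nat) (phi : 'M[D]_m.+1 -> galg gT),
    [/\ forall d : D, d != 0 -> d \is a GRing.unit,
        [/\ {morph phi : x y / x + y}, {morph phi : x y / x * y}
          & phi 1 = e],
        injective phi,
        forall a, A a <-> exists x, phi x = a
      & (\dim_('Z({: D})) {: D} = r ^ 2)%N].

End Relative.

Section Chain.

Variables (gT : finGroupType) (H : {group gT}) (lambda : 'CF(H)).
Variable Hs : nat -> {group gT}.

Definition ch_e (i : nat) : galg gT := eQ ('Ind[Hs i] lambda).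
Definition ch_C (i : nat) : {set gT} := gcent (Hs i.+1) (ch_e i).
Definition ch_k (i : nat) : nat := #|Hs i.+1 : ch_C i|.

(* The degree [G : H] / \prod_i k_i of EE/FF. *)
Definition ch_deg (n : nat) : nat := (\prod_(i < n) #|(ch_C i / Hs i)%g|)%N.

(* t i l is t_(i, l+1). *)
Variable t : nat -> nat -> gT.

Definition ch_T (i : nat) : {set gT} :=
  [set t i (l : 'I_(ch_k i)) | l : 'I_(ch_k i)].

Definition right_transversals (n : nat) : Prop :=
  forall i, (i < n)%N ->
    t i 0%N = 1%g /\
    is_transversal (ch_T i) (rcosets (ch_C i) (Hs i.+1)) (Hs i.+1).

Definition prod_T (n : nat) : {set gT} := (\prod_(i < n) ch_T i)%g.

Definition ch_theta (i : nat) (b : galg gT) : 'M[galg gT]_(ch_k i) :=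
  \matrix_(l, m)
    (ch_e i * gdelta (t i l) * b * gdelta (t i m)^-1 * ch_e i).

(* M_k(S), by nested blocks, as a subset of Q(H_n)e_n.  The entries of [ch_theta]
   lie in Q(C_i)e_i, which contains Q(H_i)e_i and hence the blocks. *)
Fixpoint nested_mx (S : galg gT -> Prop) (n : nat) (b : galg gT) : Prop :=
  if n is i.+1 then
    b \in QGe (Hs i.+1) (ch_e i.+1) /\
    forall l m, nested_mx S i (ch_theta i b l m)
  else S b.

(* x is the element of Q(H_n)e_n identified with diag(b, ..., b). *)
Fixpoint nested_diag (n : nat) (b x : galg gT) : Prop :=
  if n is i.+1 then
    x \in QGe (Hs i.+1) (ch_e i.+1) /\
    exists2 y, nested_diag i b y & ch_theta i x = y%:M
  else x = b.

Definition ch_A (n : nat) (x : galg gT) : Prop := x \in QGe (Hs n) (ch_e n).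

Definition ch_E (b : galg gT) : Prop := b \in QGe H (eQ lambda).

Definition ch_EE (n : nat) (x : galg gT) : Prop :=
  exists2 b, ch_E b & nested_diag n b x.

Definition ch_FF (n : nat) (x : galg gT) : Prop :=
  ch_A n x /\ forall y, ch_A n y -> x * y = y * x.

Definition ch_F (n : nat) (b : galg gT) : Prop :=
  ch_E b /\ exists2 x, nested_diag n b x & ch_FF n x.

Definition ch_B (n : nat) : galg gT -> Prop := nested_mx (ch_F n) n.

Definition ch_CenB (n : nat) (x : galg gT) : Prop :=
  ch_A n x /\ forall b, ch_B n b -> x * b = b * x.

End Chain.

(* Main.v *)
Require Import Defs.
From HB Require Import structures.
From mathcomp Require Import all_boot all_order all_fingroup all_algebra.
From mathcomp Require Import all_solvable all_field all_character.

Set Implicit Arguments.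
Unset Strict Implicit.
Unset Printing Implicit Defensive.

Import Order.TTheory GroupScope GRing.Theory Num.Theory.
Local Open Scope ring_scope.

(* Write eps for epsilon(H, K), P for T_0 ... T_(i-1), and p_i for the sum of
   the t^-1 eps t over t in P.  By the orthogonality of conjugates along the
   chain, the s^-1 eps t with s, t in P are matrix units with sum of the
   diagonal p_i, and e_i is a nonzero rational multiple of p_i, since e_Q(chi)
   is proportional to the sum of the tr(chi(g)) g^-1 and this sum is compatible
   with induction.  At i = n the multiple is 1, because e_n is the identity of a
   matrix ring.  The matrix units lie in B, so an element f of Cen(B) commutes
   with eps t and t^-1 eps, and t^-1 f eps t is the product of f and a diagonal
   matrix unit; this yields orthogonality and the sum.  A decomposition
   f eps = a + b lifts to one of f in Cen(B) by x |-> sum_t t^-1 x t, so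
   primitivity of f in Cen(B) gives primitivity of f eps in A. *)

(** * The trace from Q(zeta) to Q *)

Section CyclotomicTrace.

Variable gT : finGroupType.
Local Notation Qn := (QnT gT).
Local Notation QC := (QnC gT).

Lemma char_valueE (X : {group gT}) (chi : 'CF(X)) x :
  chi \is a character -> QC (char_value chi x) = chi x.
Proof.
rewrite /char_value; case: {-}_ / idP => // Nchi _.
exact/eqP/(xchooseP (char_value_subproof x Nchi)).
Qed.

Lemma QnT_galois : galois 1 {:Qn}.
Proof. exact: tagged2 (group_num_field_exists [set: gT]). Qed.

Lemma QnT_abelian : abelian 'Gal({:Qn} / 1).
Proof.
rewrite /QnT; case: (group_num_field_exists _) => L /= galL [_ _ [w [prim_w genw] _]].
have powP (s : gal_of {:L}) : exists i, s w = w ^+ i.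
  have: (s w) ^+ #|[set: gT]| = 1.
    by rewrite -rmorphXn (prim_expr_order prim_w) rmorph1.
  by case/(prim_rootP prim_w) => i ->; exists i.
apply/centsP=> x _ y _; apply/eqP/gal_eqP => a _.
have [i Di] := powP x; have [j Dj] := powP y.
(* Both automorphisms raise the root of unity [w] to a power, and [w] generates the field. *)
have cw : y (x w) = x (y w).
  by rewrite Di Dj !rmorphXn; rewrite /= Di Dj -!exprM mulnC.
have [p /polyOver1P[q ->] ->] : exists2 p, p \is a polyOver 1%VS & a = p.[w].
  by apply/Fadjoin_polyP; rewrite genw memvf.
rewrite !galM ?memvf // -!horner_map /= -!map_poly_comp.
congr (_.[_]); last exact: cw.
by apply/polyP=> k; rewrite !coef_map /= !rmorph_alg.
Qed.

(** In an abelian Galois group every subgroup is normal, so in particular each character field is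
    Galois over Q. *)
Lemma subfield_galois (E : {subfield Qn}) : galois 1 E.
Proof.
have galE : galois E {:Qn} by apply: galoisS QnT_galois; rewrite sub1v subvf.
rewrite -(galois_fixedField galE).
apply: (normal_fixedField_galois QnT_galois).
by rewrite -sub_abelian_normal ?QnT_abelian //; apply: galS (sub1v _).
Qed.

(** Restriction to E is a surjection of Galois groups with kernel Gal(Qn / E), so each of its fibres
    is a coset of that kernel. The trace from Q(chi) is thus the trace from one common field, up to
    a positive factor. *)
Lemma sum_gal_restrict (E : {subfield Qn}) a : a \in E ->
  \sum_(s in 'Gal({:Qn} / 1)) s a
    = #|'Gal({:Qn} / E)|%:R * \sum_(s in 'Gal(E / 1)) s a.
Proof.
move=> Ea; have /and3P[_ _ nE] := subfield_galois E.
have sE : (1 <= E <= {:Qn})%VS by rewrite sub1v subvf.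
have img := normalField_img QnT_galois sE nE.
rewrite (eq_bigr (fun s : gal_of {:Qn} => (normalField_cast E s) a)); last first.
  by move=> s galS; rewrite (normalField_cast_eq sE nE).
rewrite (partition_big_imset (normalField_cast E)) /= mulr_sumr.
have -> : normalField_cast E @: 'Gal({:Qn} / 1) = 'Gal(E / 1).
  by rewrite -img morphimEdom.
apply: eq_bigr => y; rewrite -{1}img => /morphimP[x galx _ ->{y}].
rewrite (eq_bigr (fun=> normalField_cast E x a)); last by move=> s /andP[_ /eqP->].
rewrite sumr_const mulr_natl; congr (_ *+ _).
rewrite -(normalField_ker sE nE) -(card_rcoset _ x); apply: eq_card => s.
rewrite unfold_in; apply/andP/idP => [[gals /eqP es] | ].
  exact/(rcoset_kerP (normalField_cast_morphism sE nE)).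
move=> sx; have gals : s \in 'Gal({:Qn} / 1).
  case/rcosetP: sx => k /(dom_ker) galk ->; exact: groupM.
by split=> //; apply/eqP/(rcoset_kerP (normalField_cast_morphism sE nE)).
Qed.

(** The trace is taken from the common cyclotomic field, because a character and the characters
    induced from it may have different fields of values. *)
Definition trQ (a : Qn) : rat :=
  getCrat (\sum_(s in 'Gal({:Qn} / 1)) QC (s a)).

Lemma trQE a : ratr (trQ a) = \sum_(s in 'Gal({:Qn} / 1)) QC (s a) :> algC.
Proof.
apply: getCratK; rewrite -rmorph_sum.
have /vlineP[c Dc] := mem_galTrace QnT_galois (memvf a).
by rewrite -[X in QC X]/(galTrace 1 {:Qn} a) Dc alg_num_field fmorph_rat Crat_rat.
Qed.

Lemma trQD a b : trQ (a + b) = trQ a + trQ b.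
Proof.
apply: (fmorph_inj (@ratr algC)); rewrite rmorphD /= !trQE -big_split /=.
by apply: eq_bigr => s _; rewrite !rmorphD.
Qed.

Lemma trQ0 : trQ 0 = 0.
Proof. by apply: (addIr (trQ 0)); rewrite -trQD !add0r. Qed.

Lemma trQ_sum (I : finType) (P : pred I) (F : I -> Qn) :
  trQ (\sum_(i | P i) F i) = \sum_(i | P i) trQ (F i).
Proof. exact: (big_morph trQ trQD trQ0). Qed.

Lemma trQ_rat (q : rat) a : trQ (ratr q * a) = q * trQ a.
Proof.
apply: (fmorph_inj (@ratr algC)); rewrite rmorphM /= !trQE mulr_sumr.
by apply: eq_bigr => s _; rewrite (rmorphM s) fmorph_rat rmorphM fmorph_rat.
Qed.

End CyclotomicTrace.

(** * Group algebra *)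

Section GroupAlgebraTheory.

Variable gT : finGroupType.
Implicit Types (a b : galg gT) (x y g : gT) (X H : {group gT}).

Lemma gdelta_mulE x a y : (gdelta x * a) y = a (x^-1 * y)%g.
Proof.
rewrite [LHS]ffunE (bigD1 x) //= big1 ?addr0 ?ffunE ?eqxx ?mul1r // => z /negPf zx.
by rewrite ffunE zx mul0r.
Qed.

Lemma gdelta1 : gdelta 1 = 1 :> galg gT.
Proof. by []. Qed.

Lemma gdeltaM x y : gdelta (x * y)%g = gdelta x * gdelta y.
Proof.
apply/ffunP=> z; rewrite gdelta_mulE !ffunE.
by rewrite -[in RHS](inj_eq (mulgI x)) mulKVg.
Qed.

Lemma gdeltaVK x a : gdelta x^-1 * (gdelta x * a) = a.
Proof. by rewrite mulrA -gdeltaM mulVg gdelta1 mul1r. Qed.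

Lemma gdeltaKV x a : gdelta x * (gdelta x^-1 * a) = a.
Proof. by rewrite mulrA -gdeltaM mulgV gdelta1 mul1r. Qed.

Lemma galg_sumE a : a = \sum_x a x *: gdelta x.
Proof.
apply/ffunP=> y; rewrite sum_ffunE (bigD1 y) //= big1 => [|x /negPf xy].
  by rewrite !ffunE eqxx addr0 [_ *: _]mulr1.
by rewrite !ffunE eq_sym xy [_ *: _]mulr0.
Qed.

Lemma QGP X a : reflect (forall x, x \notin X -> a x = 0) (a \in QG X).
Proof.
apply: (iffP idP) => [|a0].
  move=> /coord_span-> x X'x; set s := map_tuple _ _.
  rewrite sum_ffunE big1 // => i _; rewrite !ffunE.
  have /mapP[y Xy ->] : s`_i \in s by rewrite mem_nth ?size_tuple.
  rewrite ffunE; case: eqP => [xy|_]; last by rewrite [_ *: _]mulr0.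
  by rewrite xy -mem_enum Xy in X'x.
rewrite [a]galg_sumE; apply: memv_suml => x _.
have [Xx|/a0->] := boolP (x \in X); last by rewrite scale0r mem0v.
by rewrite memvZ ?memv_span //; apply: map_f; rewrite mem_enum.
Qed.

Lemma gdelta_QG X x : x \in X -> gdelta x \in QG X.
Proof.
move=> Xx; apply/QGP => y X'y; rewrite ffunE; case: eqP => // yx.
by rewrite yx Xx in X'y.
Qed.

Lemma QGS X H a : X \subset H -> a \in QG X -> a \in QG H.
Proof. by move=> /subsetP sXH /QGP a0; apply/QGP => x /(contra (sXH x))/a0. Qed.

Lemma QGM X a b : a \in QG X -> b \in QG X -> a * b \in QG X.
Proof.
move=> /QGP a0 /QGP b0; apply/QGP => x X'x; rewrite ffunE big1 // => y _.
have [Xy|/a0->] := boolP (y \in X); last by rewrite mul0r.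
by rewrite b0 ?mulr0 // groupMl ?groupV.
Qed.

Lemma gconjE a x : gconj a x = gdelta x^-1 * a * gdelta x.
Proof. by []. Qed.

Lemma gconj_delta x y : gconj (gdelta x) y = gdelta (x ^ y)%g.
Proof. by rewrite gconjE -!gdeltaM conjgE mulgA. Qed.

Lemma gconjM a b x : gconj (a * b) x = gconj a x * gconj b x.
Proof. by rewrite !gconjE !mulrA -[_ * gdelta x * _]mulrA -gdeltaM mulgV mulr1. Qed.

Lemma gconjD a b x : gconj (a + b) x = gconj a x + gconj b x.
Proof. by rewrite !gconjE mulrDr mulrDl. Qed.

Lemma gconj_sum x (I : finType) (P : pred I) (F : I -> galg gT) :
  gconj (\sum_(i | P i) F i) x = \sum_(i | P i) gconj (F i) x.
Proof. by rewrite gconjE mulr_sumr mulr_suml. Qed.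

Lemma gconjZ q a x : gconj (q *: a) x = q *: gconj a x.
Proof. by rewrite !gconjE -scalerAr -scalerAl. Qed.

Lemma gconj_mul a x y : gconj a (x * y)%g = gconj (gconj a x) y.
Proof. by rewrite !gconjE invMg !gdeltaM !mulrA. Qed.

Lemma gconj1 a : gconj a 1%g = a.
Proof. by rewrite gconjE invg1 gdelta1 mul1r mulr1. Qed.

Lemma gconj_fixP a x : gconj a x = a <-> gdelta x * a = a * gdelta x.
Proof.
split=> [/(congr1 ( *%R (gdelta x)))|E].
  by rewrite gconjE -!mulrA gdeltaKV => ->.
by rewrite gconjE -mulrA -E gdeltaVK.
Qed.

Lemma gconj_QG X a x : x \in X -> a \in QG X -> gconj a x \in QG X.
Proof. by move=> Xx Xa; rewrite !QGM ?gdelta_QG ?groupV. Qed.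

(** * Trace elements of characters and their behaviour under induction *)

Definition trace_elt X (chi : 'CF(X)) : galg gT :=
  \sum_(g in X) trQ (char_value chi g) *: gdelta g^-1.

(** The factor is chi(1) / (|X| N), where N is the order of Gal(Qn / Q(chi)) and comes from
    [sum_gal_restrict]. *)
Lemma eQ_trace_elt X (chi : 'CF(X)) :
    chi \is a character -> chi 1%g != 0 ->
  exists2 r, r != 0 & eQ chi = r *: trace_elt chi.
Proof.
move=> Nchi nz_chi; set E := char_field chi.
pose N := #|'Gal({:QnT gT} / E)|.
have nzN : N%:R != 0 :> algC by rewrite pnatr_eq0 -lt0n cardG_gt0.
have nzX : #|X|%:R != 0 :> algC by rewrite pnatr_eq0 -lt0n cardG_gt0.
pose r := (Num.truncn (chi 1%g))%:R / #|X|%:R / N%:R : rat.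
have Dr : ratr r = chi 1%g / #|X|%:R / N%:R :> algC.
  by rewrite !fmorph_div !rmorph_nat truncnK // Cnat_char1.
exists r.
  rewrite -(fmorph_eq0 (@ratr algC)) /= Dr.
  by rewrite !mulf_neq0 // invr_eq0.
rewrite /eQ scaler_sumr; apply: eq_bigr => g Xg; rewrite scalerA; congr (_ *: _).
have Eg : char_value chi g \in E.
  by apply: seqv_sub_adjoin; apply: map_f; rewrite mem_enum.
rewrite -[RHS]ratCK; congr getCrat; rewrite rmorphM /= Dr trQE.
rewrite -!(rmorph_sum (QnC gT)) (sum_gal_restrict Eg) rmorphM rmorph_nat.
by rewrite mulrA divfK.
Qed.

Lemma char_value_out X (chi : 'CF(X)) g :
  chi \is a character -> g \notin X -> char_value chi g = 0.
Proof.
move=> Nchi X'g; apply: (fmorph_inj (QnC gT)).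
by rewrite char_valueE // cfun0 // rmorph0.
Qed.

Lemma trace_elt_Ind X H (chi : 'CF(H)) : chi \is a character -> H \subset X ->
  trace_elt ('Ind[X] chi) = #|H|%:R^-1 *: \sum_(x in X) gconj (trace_elt chi) x.
Proof.
move=> Nchi sHX.
have cvE g : char_value ('Ind[X] chi) g
    = ratr #|H|%:R^-1 * \sum_(y in X) char_value chi (g ^ y).
  apply: (fmorph_inj (QnC gT)); rewrite char_valueE ?cfInd_char // cfIndE //.
  rewrite rmorphM /= fmorph_rat fmorphV rmorph_nat rmorph_sum; congr (_ * _).
  by apply: eq_bigr => y _; rewrite char_valueE.
rewrite /trace_elt (eq_bigr _ (fun g _ => congr1 (fun c => trQ c *: _) (cvE g))).
under eq_bigr => g _ do rewrite trQ_rat trQ_sum -scalerA scaler_suml.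
rewrite -scaler_sumr exchange_big /=; congr (_ *: _).
(* Replacing y by its inverse and then g by its conjugate under y moves the conjugation from the
   argument of [chi] to the group element; the terms outside H vanish. *)
rewrite (reindex_inj invg_inj) /=; apply: eq_big => [y|y]; rewrite groupV // => Xy.
rewrite gconj_sum (reindex_inj (conjg_inj y)) /=.
rewrite (eq_bigl (mem X)) => [|g]; last exact: groupJr.
rewrite (big_setID H) /= [X in _ + X]big1 => [|g /setDP[_ H'g]]; last first.
  by rewrite conjgK char_value_out // trQ0 scale0r.
rewrite addr0 (setIidPr sHX); apply: eq_bigr => g _.
by rewrite gconjZ gconj_delta conjVg conjgK.
Qed.

End GroupAlgebraTheory.

(** * e_Q(lambda) and epsilon(H, K) *)

Section LinearCharacter.

Variables (gT : finGroupType) (H : {group gT}) (lambda : 'CF(H)).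
Hypothesis lin : lambda \is a linear_char.
Implicit Types (a b : galg gT) (j : nat).

Local Notation K := (cfker lambda).

(* The linear extension of [lambda ^+ j] to the group algebra of H. *)
Definition lin_eval j b : algC := \sum_(h in H) ratr (b h) * lambda h ^+ j.

Lemma lin_evalD j a b : lin_eval j (a + b) = lin_eval j a + lin_eval j b.
Proof.
rewrite -big_split; apply: eq_bigr => h _ /=.
by rewrite ffunE rmorphD mulrDl.
Qed.

Lemma lin_evalZ j q b : lin_eval j (q *: b) = ratr q * lin_eval j b.
Proof.
rewrite mulr_sumr; apply: eq_bigr => h _ /=.
by rewrite ffunE [q *: _]/(q * _) rmorphM mulrA.
Qed.

Lemma lin_evalB j a b : lin_eval j (a - b) = lin_eval j a - lin_eval j b.
Proof. by rewrite -scaleN1r lin_evalD lin_evalZ rmorphN1 mulN1r. Qed.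

Lemma lin_eval_sum j (I : finType) (P : pred I) (F : I -> galg gT) :
  lin_eval j (\sum_(i | P i) F i) = \sum_(i | P i) lin_eval j (F i).
Proof.
apply: (big_morph _ (lin_evalD j)); rewrite /lin_eval big1 // => h _.
by rewrite ffunE rmorph0 mul0r.
Qed.

Lemma lin_eval_delta j h : h \in H -> lin_eval j (gdelta h) = lambda h ^+ j.
Proof.
move=> Hh; rewrite /lin_eval (bigD1 h) //= big1 => [|g /andP[_ /negPf gh]].
  by rewrite ffunE eqxx rmorph1 mul1r addr0.
by rewrite ffunE gh rmorph0 mul0r.
Qed.

Lemma lin_evalM j a b : a \in QG H -> b \in QG H ->
  lin_eval j (a * b) = lin_eval j a * lin_eval j b.
Proof.
move=> /QGP a0 /QGP b0; rewrite /lin_eval mulr_suml.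
under eq_bigr => h _ do rewrite ffunE rmorph_sum mulr_suml.
rewrite exchange_big (bigID [in H]) /= addrC big1 ?add0r => [|y H'y]; last first.
  by apply: big1 => h _; rewrite a0 // mul0r rmorph0 mul0r.
apply: eq_bigr => y Hy; rewrite (reindex_inj (mulgI y)) /= mulr_sumr.
apply: eq_big => [h|h]; rewrite groupMl // => Hh.
by rewrite mulKg rmorphM (lin_charM lin) // exprMn mulrACA.
Qed.

Lemma lin_char_expg h : h \in H -> lambda h ^+ #|H| = 1.
Proof.
by move=> Hh; rewrite -(lin_charX lin) // expg_cardG // lin_char1.
Qed.

Lemma mem_cfker h : h \in H -> (h \in K) = (lambda h == 1).
Proof. by move=> Hh; rewrite cfkerEchar ?lin_charW // inE Hh lin_char1. Qed.

(* Fourier inversion on the characters [lambda ^+ j] of H / K. *)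
Lemma lin_eval_inj b : b \in QG H ->
  {in K, forall k, gdelta k * b = b} -> (forall j, lin_eval j b = 0) -> b = 0.
Proof.
move=> /QGP b0 bK ev0; apply/ffunP=> g; rewrite ffunE.
have [Hg|/b0//] := boolP (g \in H).
have nzg : lambda g != 0 by exact: lin_char_neq0.
(* By orthogonality this sum isolates |H| times the sum of the b(h) over all h with lambda(h) =
   lambda(g). *)
have : \sum_(j < #|H|) lin_eval j b * (lambda g)^-1 ^+ j = 0 :> algC.
  by apply: big1 => j _; rewrite ev0 mul0r.
under eq_bigr => j _ do rewrite mulr_suml.
rewrite exchange_big /= (bigID [pred h | lambda h == lambda g]) /=.
rewrite [X in _ + X]big1 ?addr0 => [|h /andP[Hh neq]]; last first.
  under eq_bigr => j _ do rewrite -mulrA -exprMn.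
  (* Here z is an |H|-th root of unity other than 1, so its geometric sum vanishes. *)
  rewrite -mulr_sumr; set z := _ / _.
  have z1 : z - 1 != 0.
    rewrite subr_eq0; apply: contra neq => /eqP/(canRL (divfK nzg)) ->.
    by rewrite mul1r.
  have : (z - 1) * \sum_(j < #|H|) z ^+ j = 0.
    rewrite -subrX1 exprMn exprVn !lin_char_expg //.
    by rewrite invr1 mulr1 subrr.
  by move/eqP; rewrite mulf_eq0 (negPf z1) => /eqP->; rewrite mulr0.
rewrite (eq_bigr (fun=> ratr (b g) * #|H|%:R)) => [|h /andP[Hh /eqP eqh]].
  rewrite sumr_const => /eqP; rewrite mulrn_eq0 mulf_eq0 fmorph_eq0 pnatr_eq0.
  rewrite orbC -[_ == 0%N]negbK -lt0n cardG_gt0 orbF => /orP[/eqP//|].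
  by rewrite eqn0Ngt; case/negP; apply/card_gt0P; exists g; rewrite unfold_in Hg eqxx.
(* The elements g and h lie in one coset of K, and b is constant on such cosets. *)
have -> : b h = b g.
  have Kk : (g * h^-1)%g \in K.
    rewrite mem_cfker ?groupM ?groupV // (lin_charM lin) ?groupV //.
    by rewrite (lin_charV lin) // eqh divff.
  by rewrite -[in RHS](bK _ Kk) gdelta_mulE invMg invgK mulgKV.
transitivity (\sum_(j < #|H|) (ratr (b g) : algC)).
  by apply: eq_bigr => j _; rewrite eqh exprVn mulfK // expf_neq0.
by rewrite sumr_const card_ord mulr_natr.
Qed.

(** * Values of the powers of lambda at subgroup averages and at epsilon(H, K) *)

Lemma ghat_QG (L : {group gT}) : L \subset H -> ghat L \in QG H.
Proof.
move=> sLH; rewrite memvZ // memv_suml // => x Lx.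
by rewrite gdelta_QG ?(subsetP sLH).
Qed.

Lemma gdelta_ghat (L : {group gT}) x : x \in L -> gdelta x * ghat L = ghat L.
Proof.
move=> Lx; rewrite -scalerAr mulr_sumr; congr (_ *: _).
rewrite [RHS](reindex_inj (mulgI x)) /=.
by apply: eq_big => y; rewrite ?groupMl // gdeltaM.
Qed.

Lemma lin_eval_ghat1 j (L : {group gT}) : L \subset H ->
  {in L, forall x, lambda x ^+ j = 1} -> lin_eval j (ghat L) = 1.
Proof.
move=> sLH L1; rewrite lin_evalZ lin_eval_sum (eq_bigr (fun=> 1)) => [|x Lx].
  by rewrite sumr_const fmorphV rmorph_nat mulVf // pnatr_eq0 -lt0n cardG_gt0.
by rewrite lin_eval_delta ?L1 // (subsetP sLH).
Qed.

(** Since x absorbs into the average over L, the value v satisfies lambda(x)^j v = v. *)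
Lemma lin_eval_ghat0 j (L : {group gT}) x : L \subset H ->
  x \in L -> lambda x ^+ j != 1 -> lin_eval j (ghat L) = 0.
Proof.
move=> sLH Lx x1; have Hx := subsetP sLH x Lx; apply/eqP.
have /esym/eqP := lin_evalM j (gdelta_QG Hx) (ghat_QG sLH).
rewrite gdelta_ghat // lin_eval_delta // -[X in _ == X]mul1r -subr_eq0 -mulrBl.
by rewrite mulf_eq0 subr_eq0 (negPf x1).
Qed.

Let eps := geps H [group of K].

Lemma geps_QG : eps \in QG H.
Proof.
rewrite /eps /geps; case: eqP => _; first by rewrite ghat_QG ?cfker_sub.
apply: (big_ind (fun a => a \in QG H)) => [|a b|L].
- by rewrite -gdelta1 gdelta_QG.
- exact: QGM.
move=> /mingroupp/andP[_ /andP[sLH _]].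
by rewrite rpredB ?ghat_QG ?cfker_sub.
Qed.

Lemma geps_ker : {in K, forall k, gdelta k * eps = eps}.
Proof.
move=> k Kk; rewrite /eps /geps; case: eqP => [|/eqP neqHK].
  by rewrite gdelta_ghat.
(* As H properly contains K, some minimal L exists; the product then has a first factor, and this
   factor already absorbs K. *)
have [L minL _] : {L : {group gT} |
    [min L | (K \proper L) && (L <| H)] & L \subset H}.
  apply: mingroup_exists; rewrite normal_refl properEneq cfker_sub !andbT.
  by apply: contra neqHK => /eqP E; apply/eqP/val_inj.
rewrite -big_filter; set s := filter _ _.
have sP M : M \in s -> K \subset M.
  by rewrite mem_filter => /andP[/mingroupp/andP[/proper_sub]].
have : L \in s by rewrite mem_filter minL mem_index_enum.
case: s sP => // M s sP _; rewrite big_cons mulrA; congr (_ * _).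
rewrite mulrBr !gdelta_ghat //.
by apply: (subsetP (sP M _)); rewrite ?mem_head.
Qed.

(** Every minimal L contains an element outside K, on which lambda^j is not 1; so each factor has
    value 1 - 0. *)
Lemma lin_eval_geps1 j : {in H, forall h, lambda h ^+ j = 1 -> h \in K} ->
  lin_eval j eps = 1.
Proof.
move=> faith.
have evK : lin_eval j (ghat K) = 1.
  apply: lin_eval_ghat1 => [|x Kx]; first exact: cfker_sub.
  have Hx := subsetP (cfker_sub lambda) x Kx.
  by move: Kx; rewrite mem_cfker // => /eqP->; rewrite expr1n.
rewrite /eps /geps; case: eqP => // _.
apply: (proj2 (A := _ \in QG H)).
apply: (big_ind (fun a => a \in QG H /\ lin_eval j a = 1)) => [|a b|L].
- by rewrite -gdelta1 gdelta_QG // lin_eval_delta // lin_char1 // expr1n.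
- by case=> Ha a1 [Hb b1]; rewrite QGM // lin_evalM // a1 b1 mulr1.
move=> /mingroupp/andP[/properP[_ [x Lx K'x]] /andP[sLH _]].
split; first by rewrite rpredB ?ghat_QG ?cfker_sub.
rewrite lin_evalB evK (lin_eval_ghat0 sLH Lx) ?subr0 //.
by apply: contra K'x => /eqP/faith; apply; apply: (subsetP sLH).
Qed.

(** The kernel M of lambda^j properly contains K, hence contains a minimal L, and the factor of this
    L has value 1 - 1. *)
Lemma lin_eval_geps0 j h : h \in H -> lambda h ^+ j = 1 -> h \notin K ->
  lin_eval j eps = 0.
Proof.
move=> Hh h1 K'h; pose M := [group of cfker (lambda ^+ j)].
have linj : lambda ^+ j \is a linear_char by rewrite rpredX.
have MP x : x \in H -> (x \in M) = (lambda x ^+ j == 1).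
  move=> Hx; rewrite /= cfkerEchar ?lin_charW // inE Hx (lin_char1 linj).
  by rewrite exp_cfunE.
have sMH : M \subset H := cfker_sub _.
have evK : lin_eval j (ghat K) = 1.
  apply: lin_eval_ghat1 => [|x Kx]; first exact: cfker_sub.
  have Hx := subsetP (cfker_sub lambda) x Kx.
  by move: Kx; rewrite mem_cfker // => /eqP->; rewrite expr1n.
have [L minL sLM] : {L : {group gT} |
    [min L | (K \proper L) && (L <| H)] & L \subset M}.
  apply: mingroup_exists; rewrite cfker_normal andbT; apply/properP; split.
    apply/subsetP=> x Kx; have Hx := subsetP (cfker_sub lambda) x Kx.
    by move: Kx; rewrite MP // mem_cfker // => /eqP->; rewrite expr1n.
  by exists h; rewrite // MP // h1.
have /negPf neqHK : H != [group of K].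
  by apply: contra K'h => /eqP E; rewrite -[K]/(gval [group of K]) -E.
rewrite /eps /geps neqHK.
(* Membership in QH is carried along because [lin_eval] is shown multiplicative only there. *)
have [prodE _] : lin_eval j (\prod_(L : {group gT} |
      [min L | (K \proper L) && (L <| H)]) (ghat K - ghat L))
    = \prod_(L : {group gT} | [min L | (K \proper L) && (L <| H)])
         lin_eval j (ghat K - ghat L)
  /\ \prod_(L : {group gT} |
      [min L | (K \proper L) && (L <| H)]) (ghat K - ghat L) \in QG H.
  apply: (big_ind2 (fun a c => lin_eval j a = c /\ a \in QG H)) => [|a c b d|N].
  - by rewrite -gdelta1 gdelta_QG // lin_eval_delta // lin_char1 // expr1n.
  - by case=> <- Ha [<- Hb]; rewrite QGM // lin_evalM.
  move=> /mingroupp/andP[_ /andP[sNH _]].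
  by rewrite rpredB ?ghat_QG ?cfker_sub.
rewrite prodE (bigD1 L) //= lin_evalB evK lin_eval_ghat1 ?subrr ?mul0r //.
  exact: subset_trans sLM sMH.
move=> x /(subsetP sLM) Mx; apply/eqP; rewrite -MP //; exact: (subsetP sMH).
Qed.

(** Identities involving [eps] become comparisons of values, which are 1 or 0 according to the two
    cases of [power_faithfulVkernel]. *)
Lemma lin_eval_eq a b : a \in QG H -> b \in QG H ->
    {in K, forall k, gdelta k * a = a} -> {in K, forall k, gdelta k * b = b} ->
    (forall j, lin_eval j a = lin_eval j b) -> a = b.
Proof.
move=> Ha Hb aK bK eqab; apply/subr0_eq/lin_eval_inj => [|k Kk|j].
- exact: rpredB.
- by rewrite mulrBr aK ?bK.
- by rewrite lin_evalB eqab subrr.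
Qed.

Lemma power_faithfulVkernel j :
  {in H, forall h, lambda h ^+ j = 1 -> h \in K} \/
  (exists h, [/\ h \in H, lambda h ^+ j = 1 & h \notin K]).
Proof.
have [/existsP[h /and3P[Hh /eqP h1 K'h]] | none] :=
  boolP [exists h, [&& h \in H, lambda h ^+ j == 1 & h \notin K]].
  by right; exists h.
left=> h Hh h1; apply: contraR none => K'h; apply/existsP; exists h.
by rewrite Hh h1 eqxx.
Qed.

Lemma geps_idem : eps * eps = eps.
Proof.
apply: lin_eval_eq; rewrite ?QGM ?geps_QG //.
- by move=> k Kk; rewrite mulrA geps_ker.
- exact: geps_ker.
move=> j; rewrite lin_evalM ?geps_QG //.
have [faith|[h [Hh h1 K'h]]] := power_faithfulVkernel j.
  by rewrite lin_eval_geps1 // mulr1.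
by rewrite (lin_eval_geps0 Hh h1) // mulr0.
Qed.

Lemma geps_neq0 : eps != 0.
Proof.
have : lin_eval 1 eps = 1.
  by apply: lin_eval_geps1 => h Hh; rewrite expr1 mem_cfker // => /eqP.
apply: contra_eq_neq => ->; rewrite -(scale0r (0 : galg gT)) lin_evalZ rmorph0.
by rewrite mul0r eq_sym oner_neq0.
Qed.

Lemma geps_gconj h : h \in H -> gconj eps h = eps.
Proof.
move=> Hh; apply/gconj_fixP; apply: lin_eval_eq.
- by rewrite QGM ?geps_QG ?gdelta_QG.
- by rewrite QGM ?geps_QG ?gdelta_QG.
- move=> k Kk; rewrite mulrA -gdeltaM conjgC gdeltaM -mulrA geps_ker //.
  by rewrite memJ_norm // (subsetP (normal_norm (cfker_normal lambda))).
- by move=> k Kk; rewrite mulrA geps_ker.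
by move=> j; rewrite !lin_evalM ?geps_QG ?gdelta_QG // mulrC.
Qed.

(* The hypothesis makes j prime to the order of lambda. *)
Lemma lin_eval_power_aut j : {in H, forall h, lambda h ^+ j = 1 -> h \in K} ->
  exists u : {rmorphism algC -> algC},
    forall b, lin_eval j b = u (lin_eval 1 b).
Proof.
move=> faith; have cop : coprime j #[lambda]%CF.
  set m := #[lambda]%CF; set d := gcdn j m.
  have m_gt0 : (0 < m)%N by exact: cforder_lin_char_gt0.
  have Dm : m = (m %/ d * d)%N by rewrite divnK ?dvdn_gcdr.
  (* As m divides (m / d) j, each h^(m/d) is sent to 1 by lambda^j and so lies in K; hence
     lambda^(m/d) is trivial, which forces d = 1. *)
  have : (m %| m %/ d)%N.
    rewrite dvdn_cforder; apply/eqP/cfun_inP=> h Hh.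
    rewrite exp_cfunE // cfun1E Hh -(lin_charX lin) //; apply/eqP.
    rewrite -mem_cfker; last exact: groupX.
    apply: faith; first exact: groupX.
    rewrite (lin_charX lin) // -exprM -exp_cfunE //.
    have /eqP-> : lambda ^+ (m %/ d * j) == 1; last by rewrite cfun1E Hh.
    by rewrite -dvdn_cforder -/m {1}Dm dvdn_mul ?dvdn_gcdl.
  move/dvdn_leq; rewrite divn_gt0 ?gcdn_gt0 ?m_gt0 ?orbT //.
  rewrite dvdn_leq ?dvdn_gcdr // => /(_ isT).
  rewrite {1}Dm -[X in (_ <= X)%N]muln1 leq_pmul2l; last first.
    by rewrite divn_gt0 ?gcdn_gt0 ?m_gt0 ?orbT // dvdn_leq ?dvdn_gcdr.
  by rewrite /coprime -/d eqn_leq => ->; rewrite gcdn_gt0 m_gt0 orbT.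
(* The automorphism u raises the roots of unity of order dividing that of lambda to the j-th
   power. *)
have [u Du] := Qn_aut_exists cop; exists u => b.
rewrite rmorph_sum; apply: eq_bigr => h Hh; rewrite rmorphM fmorph_rat expr1 Du //.
rewrite -exp_cfunE // (eqP (_ : lambda ^+ #[lambda]%CF == 1)) ?cfun1E ?Hh //.
by rewrite -dvdn_cforder.
Qed.

(** * The trace element of lambda as a multiple of epsilon(H, K) *)

Lemma trace_elt_QG : trace_elt lambda \in QG H.
Proof.
by apply: memv_suml => g Hg; rewrite memvZ // gdelta_QG // groupV.
Qed.

Lemma trace_elt_ker :
  {in K, forall k, gdelta k * trace_elt lambda = trace_elt lambda}.
Proof.
move=> k Kk; have Hk := subsetP (cfker_sub lambda) k Kk; rewrite mulr_sumr.
rewrite [RHS](reindex_inj (mulIg k^-1%g)) /=.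
apply: eq_big => g; rewrite ?groupMr ?groupV // => Hg.
rewrite -scalerAr -gdeltaM invMg invgK; congr (trQ _ *: _).
apply: (fmorph_inj (QnC gT)); rewrite !char_valueE ?lin_charW //.
rewrite (lin_charM lin) ?groupV // (lin_charV lin) //.
by move: Kk; rewrite mem_cfker // => /eqP->; rewrite invr1 mulr1.
Qed.

(** If f(x) differs from 1 for some x, translation by x shows that the sum is unchanged by the
    factor f(x), hence zero. *)
Lemma sum_multiplicative (f : gT -> algC) :
    {in H &, forall x y, f (x * y)%g = f x * f y} ->
  \sum_(h in H) f h = if [forall h in H, f h == 1] then #|H|%:R else 0.
Proof.
move=> fM; case: ifP => [/forall_inP f1 | /negbT].
  rewrite (eq_bigr (fun=> 1)) => [|h /f1/eqP //].
  by rewrite sumr_const.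
case/forall_inPn=> x Hx fx1; apply/eqP.
have : f x * (\sum_(h in H) f h) = \sum_(h in H) f h.
  rewrite mulr_sumr [RHS](reindex_inj (mulgI x)) /=.
  by apply: eq_big => h; rewrite ?groupMl // => Hh; rewrite fM.
move/eqP; rewrite -[X in _ == X]mul1r -subr_eq0 -mulrBl mulf_eq0 subr_eq0.
by rewrite (negPf fx1).
Qed.

(** On H this is the product of s(lambda) and lambda^(-j), which is trivial exactly when s(lambda) =
    lambda^j. *)
Definition gal_twist j (s : gal_of {:QnT gT}) (g : gT) : algC :=
  QnC gT (s (char_value lambda g)) * lambda g^-1%g ^+ j.

Lemma char_value_lin1 g : g \in H -> (char_value lambda g == 1) = (g \in K).
Proof.
move=> Hg; rewrite -(inj_eq (fmorph_inj (QnC gT))) rmorph1.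
by rewrite char_valueE ?lin_charW // mem_cfker.
Qed.

Lemma lin_eval_trace_elt j : lin_eval j (trace_elt lambda) =
  \sum_(s in 'Gal({:QnT gT} / 1))
    (if [forall h in H, gal_twist j s h == 1] then #|H|%:R else 0).
Proof.
rewrite lin_eval_sum.
transitivity (\sum_(g in H) \sum_(s in 'Gal({:QnT gT} / 1)) gal_twist j s g).
  apply: eq_bigr => g Hg; rewrite lin_evalZ lin_eval_delta ?groupV //.
  by rewrite trQE mulr_suml.
rewrite exchange_big; apply: eq_bigr => s _ /=; apply: sum_multiplicative.
move=> x y Hx Hy; rewrite /gal_twist.
have -> : char_value lambda (x * y)%g = char_value lambda x * char_value lambda y.
  apply: (fmorph_inj (QnC gT)); rewrite rmorphM !char_valueE ?lin_charW //.
  exact: (lin_charM lin).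
rewrite invMg (lin_charM lin) ?groupV // [s _]rmorphM rmorphM exprMn.
by rewrite [X in _ * X]mulrC mulrACA.
Qed.

Lemma trace_elt_geps : exists2 q, q != 0 & trace_elt lambda = q *: eps.
Proof.
pose q := \sum_(s in 'Gal({:QnT gT} / 1))
    (if [forall h in H, gal_twist 1 s h == 1] then #|H|%:R else 0) : rat.
have Dq : lin_eval 1 (trace_elt lambda) = ratr q.
  rewrite lin_eval_trace_elt rmorph_sum; apply: eq_bigr => s _.
  by case: ifP; rewrite (rmorph0, rmorph_nat).
have faith1 : {in H, forall h, lambda h ^+ 1 = 1 -> h \in K}.
  by move=> h Hh; rewrite expr1 mem_cfker // => /eqP.
(* The identity automorphism contributes |H| to q and no term is negative, so q > 0. *)
exists q.
  rewrite /q (bigD1 1%g) ?group1 //= ifT; last first.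
    apply/forall_inP=> h Hh; rewrite /gal_twist gal_id char_valueE ?lin_charW //.
    by rewrite expr1 (lin_charV lin) // divff // lin_char_neq0.
  rewrite gt_eqF // ltr_wpDr ?ltr0n ?cardG_gt0 // sumr_ge0 // => s _.
  by case: ifP; rewrite ?ler0n.
apply: lin_eval_eq => [|||k Kk|j]; first exact: trace_elt_QG.
- by rewrite memvZ ?geps_QG.
- exact: trace_elt_ker.
- by rewrite -scalerAr geps_ker.
rewrite lin_evalZ.
have [faith|[h [Hh h1 K'h]]] := power_faithfulVkernel j.
  (* The value at j is the image under u of the value at 1, and u fixes the rational number q. *)
  have [u ->] := lin_eval_power_aut faith.
  by rewrite lin_eval_geps1 // mulr1 Dq fmorph_rat.
rewrite (lin_eval_geps0 Hh h1) // mulr0 lin_eval_trace_elt big1 // => s _.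
(* If s(lambda) = lambda^j on H, then s maps lambda(h) to 1, so lambda(h) = 1 and h lies in K. *)
rewrite ifF //; apply: contraNF K'h => /forall_inP/(_ h Hh).
rewrite /gal_twist (lin_charV lin) // exprVn h1 invr1 mulr1.
by rewrite !fmorph_eq1 char_value_lin1.
Qed.

End LinearCharacter.

(** * Strong inductive chains *)

Section Transversals.

Variables (gT : finGroupType) (X C : {group gT}) (T : {set gT}).
Hypotheses (sCX : C \subset X) (trT : is_transversal T (rcosets C X) X).

Lemma transversal_sub : T \subset X.
Proof. by case/and3P: trT. Qed.

Lemma transversal_repr x : x \in X -> exists2 t, t \in T & (x * t^-1)%g \in C.
Proof.
move=> Xx; case/and3P: trT => _ _ /forall_inP/(_ (C :* x)).
rewrite mem_rcosets mulSGid // => /(_ Xx)/cards1P[t Dt].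
have : t \in [set t] by rewrite inE.
rewrite -Dt inE => /andP[Tt /rcosetP[c Cc Dtc]]; exists t => //.
by rewrite Dtc invMg mulKVg groupV.
Qed.

Lemma transversal_inj x y : x \in T -> y \in T -> (x * y^-1)%g \in C -> x = y.
Proof.
move=> Tx Ty; rewrite -mem_rcoset => Cxy; case/and3P: trT => _ _.
move/forall_inP/(_ (C :* y)); rewrite mem_rcosets mulSGid //.
move=> /(_ (subsetP transversal_sub y Ty))/cards1P[z Dz].
have : x \in [set z] by rewrite -Dz inE Tx.
have : y \in [set z] by rewrite -Dz inE Ty rcoset_refl.
by rewrite !inE => /eqP-> /eqP->.
Qed.

Lemma sum_transversal (V : nmodType) (F : gT -> V) :
    {in C & X, forall c x, F (c * x)%g = F x} ->
  \sum_(x in X) F x = (\sum_(x in T) F x) *+ #|C|.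
Proof.
move=> FC; have -> : X = [set (p.1 * p.2)%g | p in setX C T] :> {set gT}.
  apply/setP=> x; apply/idP/imsetP => [Xx | [[c s] /setXP[Cc Ts] ->]]; last first.
    by rewrite groupM //; [apply: (subsetP sCX) | apply: (subsetP transversal_sub)].
  have [s Ts Cxs] := transversal_repr Xx.
  by exists (x * s^-1, s)%g; rewrite ?inE /= ?Cxs ?Ts // mulgKV.
rewrite big_imset => [|[c x] [d y] /setXP[Cc Tx] /setXP[Dd Ty] /= eqxy]; last first.
  have xy : x = y.
    apply: transversal_inj => //.
    have -> : (x * y^-1 = c^-1 * d)%g by rewrite -[x](mulKg c) eqxy mulgA mulgK.
    by rewrite groupM ?groupV.
  by move: eqxy; rewrite xy => /mulIg->.
rewrite (eq_bigl (fun q => (q.1 \in C) && (q.2 \in T))) /= => [|[c x]]; last first.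
  exact: in_setX.
rewrite -(pair_big [in C] [in T] (fun c x => F (c * x)%g)) /= -sumr_const.
apply: eq_bigr => c Cc; apply: eq_bigr => x Tx.
by rewrite FC // (subsetP transversal_sub).
Qed.

Lemma card_transversalE : #|T| = #|X : C|.
Proof. by rewrite (card_transversal trT). Qed.

End Transversals.

(** * Centralizers as groups, and membership in QXe *)

Section Centralizer.

Variable gT : finGroupType.

Lemma gcent_group_set (X : {group gT}) (a : galg gT) : group_set (gcent X a).
Proof.
apply/group_setP; split=> [|x y]; first by rewrite inE group1 gconj1 eqxx.
rewrite !inE => /andP[Xx /eqP ax] /andP[Xy /eqP ay].
by rewrite groupM // gconj_mul ax ay eqxx.
Qed.

Canonical gcent_group X a := Group (gcent_group_set X a).

(** Right multiples of an idempotent p are the elements fixed by right multiplication by p. The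
    factor d is present because e_i is first known only as a nonzero multiple of an idempotent. *)
Lemma QGeP (X : {group gT}) (p x : galg gT) d :
    d != 0 -> p \in QG X -> p * p = p ->
  x \in QGe X (d *: p) <-> x \in QG X /\ x * p = x.
Proof.
move=> nzd Xp pp; split=> [/memv_cosetP[u Xu ->] | [Xx Dx]].
  by rewrite -scalerAr -scalerAl -mulrA pp memvZ // QGM.
apply/memv_cosetP; exists (d^-1 *: x); first by rewrite memvZ.
by rewrite -scalerAr -scalerAl scalerA divff // scale1r Dx.
Qed.

End Centralizer.

Section Chain.

Variables (gT : finGroupType) (H : {group gT}) (lambda : 'CF(H)) (n : nat).
Variables (Hs : nat -> {group gT}) (t : nat -> nat -> gT).
Hypothesis lin : lambda \is a linear_char.
Hypothesis Hs0 : Hs 0%N = H.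
Hypothesis sHs : forall i, (i < n)%N -> Hs i \subset Hs i.+1.
Hypothesis orth : forall i, (i < n)%N ->
  {in Hs i.+1 &, forall x y,
     gconj (ch_e lambda Hs i) x != gconj (ch_e lambda Hs i) y ->
     gconj (ch_e lambda Hs i) x * gconj (ch_e lambda Hs i) y = 0}.
Hypothesis trans : right_transversals lambda Hs t n.

Local Notation eps := (geps H [group of cfker lambda]).
Local Notation e := (ch_e lambda Hs).
Local Notation C := (ch_C lambda Hs).
Local Notation k := (ch_k lambda Hs).
Local Notation T := (ch_T lambda Hs t).
Local Notation P := (prod_T lambda Hs t).
Local Notation theta := (ch_theta lambda Hs t).

Let p i : galg gT := \sum_(s in P i) gconj eps s.

(** * The product transversal, and e_i as a multiple of p_i *)

Lemma chain_base_sub i : (i <= n)%N -> H \subset Hs i.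
Proof.
elim: i => [_|i IHi lt_in]; first by rewrite Hs0.
exact: subset_trans (IHi (ltnW lt_in)) (sHs lt_in).
Qed.

Lemma ch_e_conj_sum i : (i <= n)%N ->
  exists2 r, r != 0 & e i = r *: \sum_(x in Hs i) gconj eps x.
Proof.
move=> le_in; have sHi := chain_base_sub le_in.
have Nl := lin_charW lin; have NI := cfInd_char (Hs i) Nl.
have [|r nzr Dr] := eQ_trace_elt NI.
  rewrite cfInd1 // lin_char1 // mulr1 pnatr_eq0 -lt0n.
  exact: indexg_gt0.
have [q nzq Dq] := trace_elt_geps lin.
exists (r * (#|H|%:R^-1 * q)).
  by rewrite !mulf_neq0 // invr_eq0 pnatr_eq0 -lt0n cardG_gt0.
rewrite /ch_e Dr trace_elt_Ind // Dq -!scalerA; congr (_ *: (_ *: _)).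
by rewrite scaler_sumr; apply: eq_bigr => x _; rewrite gconjZ.
Qed.

Lemma ch_e_gconj i y : (i <= n)%N -> y \in Hs i -> gconj (e i) y = e i.
Proof.
move=> le_in Hy; have [r _ ->] := ch_e_conj_sum le_in.
rewrite gconjZ gconj_sum; congr (_ *: _).
rewrite [RHS](reindex_inj (mulIg y)) /=.
by apply: eq_big => x; rewrite ?groupMr // gconj_mul.
Qed.

Lemma Hs_subC i : (i < n)%N -> Hs i \subset C i.
Proof.
move=> lt_in; apply/subsetP=> x Hx; rewrite inE (subsetP (sHs lt_in)) //=.
by rewrite ch_e_gconj // ltnW.
Qed.

Lemma ch_T_trans i : (i < n)%N ->
  is_transversal (T i) (rcosets (C i) (Hs i.+1)) (Hs i.+1).
Proof. by case/trans. Qed.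

Lemma ch_C_sub i : C i \subset Hs i.+1.
Proof. by apply/subsetP=> x; rewrite inE => /andP[]. Qed.

Lemma ch_T_sub i : (i < n)%N -> T i \subset Hs i.+1.
Proof. by move=> lt_in; apply: transversal_sub (ch_T_trans lt_in). Qed.

Lemma prod_T0 : P 0 = [set 1%g].
Proof. by rewrite /prod_T big_ord0. Qed.

Lemma prod_TS i : P i.+1 = (P i * T i)%g.
Proof. by rewrite /prod_T big_ord_recr. Qed.

Lemma prod_T_sub i : (i <= n)%N -> P i \subset Hs i.
Proof.
elim: i => [_|i IHi lt_in]; first by rewrite prod_T0 sub1set group1.
rewrite prod_TS mul_subG ?ch_T_sub //.
exact: subset_trans (IHi (ltnW lt_in)) (sHs lt_in).
Qed.

Lemma ch_T_inj i : (i < n)%N ->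
  {in T i &, forall x y, (x * y^-1)%g \in C i -> x = y}.
Proof.
move=> lt_in x y Tx Ty.
exact: (@transversal_inj _ _ (gcent_group _ _) _ (ch_C_sub i) (ch_T_trans lt_in)).
Qed.

(** The element x x'^-1 = s^-1 s' lies in H_i, hence in C_i, so x and x' represent the same
    coset. *)
Lemma prod_T_inj i : (i < n)%N ->
  {in P i & T i, forall s x, {in P i & T i, forall s' x',
    (s * x = s' * x')%g -> s = s' /\ x = x'}}.
Proof.
move=> lt_in s x Ps Tx s' x' Ps' Tx' eqsx.
have PC r : r \in P i -> r \in gcent_group (Hs i.+1) (e i).
  move=> Pr; apply: (subsetP (Hs_subC lt_in)).
  by apply: (subsetP (prod_T_sub (ltnW lt_in))).
have xx' : x = x'.
  apply: (ch_T_inj lt_in) => //.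
  have -> : (x * x'^-1 = s^-1 * s')%g by rewrite -[x](mulKg s) eqsx mulgA mulgK.
  by rewrite groupM ?groupV ?PC.
by split=> //; move: eqsx; rewrite xx' => /mulIg.
Qed.

Lemma sum_prod_TS (V : nmodType) (F : gT -> V) i : (i < n)%N ->
  \sum_(s in P i.+1) F s = \sum_(x in T i) \sum_(s in P i) F (s * x)%g.
Proof.
move=> lt_in; have -> : P i.+1 = [set (q.1 * q.2)%g | q in setX (P i) (T i)].
  rewrite prod_TS; apply/setP=> x; apply/mulsgP/imsetP.
    by case=> s y Ps Ty ->; exists (s, y); rewrite // inE Ps.
  by case=> -[s y] /setXP[Ps Ty] ->; exists s y.
rewrite big_imset => [|[s x] [s' x'] /setXP[Ps Tx] /setXP[Ps' Tx'] /= eqsx].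
  rewrite exchange_big /=.
  rewrite (pair_big [in P i] [in T i] (fun s x => F (s * x)%g)) /=.
  by apply: eq_bigl => -[s x]; rewrite in_setX.
by have [-> ->] := prod_T_inj lt_in Ps Tx Ps' Tx' eqsx.
Qed.

Lemma prod_T_1 i : (i <= n)%N -> 1%g \in P i.
Proof.
elim: i => [_|i IHi lt_in]; first by rewrite prod_T0 inE.
rewrite prod_TS -[1%g]mulg1 mem_mulg ?IHi ?(ltnW lt_in) //.
have k_gt0 : (0 < k i)%N by apply: (@indexg_gt0 _ _ (gcent_group _ _)).
by have [<- _] := trans lt_in; apply/imsetP; exists (Ordinal k_gt0).
Qed.

(* d = 1 iff e_i is idempotent; this is derived only at i = n, in [ch_e_p],
   so that irreducibility of the lambda^(H_i) is never used. *)
Lemma ch_eE i : (i <= n)%N -> exists2 d, d != 0 & e i = d *: p i.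
Proof.
elim: i => [_|i IHi lt_in].
  have [r nzr ->] := ch_e_conj_sum (leq0n n); exists (r * #|H|%:R).
    by rewrite mulf_neq0 // pnatr_eq0 -lt0n cardG_gt0.
  rewrite /p prod_T0 big_set1 gconj1 -scalerA; congr (_ *: _).
  rewrite (eq_bigr (fun=> eps)) => [|x]; last by rewrite Hs0; apply: geps_gconj.
  by rewrite sumr_const Hs0 scaler_nat.
have [d nzd De] := IHi (ltnW lt_in).
have [r nzr Dr] := ch_e_conj_sum lt_in.
have [r' nzr' Dr'] := ch_e_conj_sum (ltnW lt_in).
have nzH : #|Hs i|%:R != 0 :> rat by rewrite pnatr_eq0 -lt0n cardG_gt0.
(* Up to the factor r', e_i is the sum of the H_i-conjugates of [eps]; summing its conjugates over
   H_(i+1) repeats the full conjugate sum |H_i| times. *)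
have avg : #|Hs i|%:R *: \sum_(x in Hs i.+1) gconj eps x
    = r'^-1 *: \sum_(x in Hs i.+1) gconj (e i) x.
  rewrite Dr'; under [X in _ = _ *: X]eq_bigr => x _ do
    rewrite gconjZ gconj_sum.
  rewrite -scaler_sumr scalerA mulVf // scale1r exchange_big /=.
  rewrite [RHS](eq_bigr (fun=> \sum_(x in Hs i.+1) gconj eps x)) => [|y Hy].
    by rewrite sumr_const scaler_nat.
  rewrite [RHS](reindex_inj (mulgI y)) /=.
  have Hy' := subsetP (sHs lt_in) y Hy.
  by apply: eq_big => x; rewrite ?groupMl // gconj_mul.
have {}avg : \sum_(x in Hs i.+1) gconj eps x
    = (#|Hs i|%:R^-1 * r'^-1) *: \sum_(x in Hs i.+1) gconj (e i) x.
  by rewrite -scalerA -avg scalerA mulVf // scale1r.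
exists (r * (#|Hs i|%:R^-1 * r'^-1) * #|C i|%:R * d).
  rewrite !mulf_neq0 ?invr_eq0 // pnatr_eq0 -lt0n.
  exact: (cardG_gt0 (gcent_group _ _)).
rewrite Dr avg -!scalerA; do 3 congr (_ *: _).
(* Conjugation of e_i depends only on the coset of C_i, so the sum over H_(i+1) reduces to T_i. *)
rewrite (@sum_transversal _ _ (gcent_group (Hs i.+1) (e i)) _ (ch_C_sub i)
  (ch_T_trans lt_in)).
  rewrite -scaler_nat; congr (_ *: _).
  rewrite /p sum_prod_TS // scaler_sumr; apply: eq_bigr => x Tx.
  rewrite De gconjZ gconj_sum; congr (_ *: _).
  by apply: eq_bigr => s _; rewrite gconj_mul.
move=> c x; rewrite inE => /andP[_ /eqP ec] _.
by rewrite gconj_mul ec.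
Qed.

(** * Matrix units from the orthogonality of conjugates *)

Lemma p_orth i x y : (i < n)%N -> x \in T i -> y \in T i -> x != y ->
  p i * gdelta x * gdelta y^-1 * p i = 0.
Proof.
move=> lt_in Tx Ty neqxy; have [d nzd De] := ch_eE (ltnW lt_in).
have Hx := subsetP (ch_T_sub lt_in) x Tx; have Hy := subsetP (ch_T_sub lt_in) y Ty.
have : gconj (e i) x * gconj (e i) y = 0.
  (* Equal conjugates would put x y^-1 in the stabilizer C_i of e_i, so that x = y. *)
  apply: orth => //; apply: contra neqxy => /eqP eqe; apply/eqP.
  apply: (ch_T_inj lt_in) => //; rewrite inE groupM ?groupV //= gconj_mul eqe.
  by rewrite -gconj_mul mulgV gconj1.
rewrite De !gconjZ -scalerAl -scalerAr scalerA => /eqP.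
rewrite scaler_eq0 mulf_eq0 (negPf nzd) /= => /eqP.
move/(congr1 (fun a => gdelta x * a * gdelta y^-1)).
rewrite mulr0 mul0r !gconjE -!mulrA gdeltaKV => <-.
by rewrite -gdeltaM mulgV gdelta1 mulr1.
Qed.

Lemma p_comm i s : (i <= n)%N -> s \in Hs i -> gdelta s * p i = p i * gdelta s.
Proof.
move=> le_in Hs_s; have [d nzd De] := ch_eE le_in.
have /gconj_fixP := ch_e_gconj le_in Hs_s.
by rewrite De -scalerAr -scalerAl => /(scalerI nzd).
Qed.

(** These are the matrix unit relations reduced to their middle factor. They form a predicate so
    that [eps_mulp] is available at level i within the induction of [matrix_units]. *)
Definition units_at i := {in P i &, forall s u,
  eps * gdelta s * gdelta u^-1 * eps = if s == u then eps else 0}.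

Lemma eps_mulp i : (i <= n)%N -> units_at i ->
  eps * p i = eps /\ p i * eps = eps.
Proof.
move=> le_in U; have P1 := prod_T_1 le_in; split.
  rewrite mulr_sumr (bigD1 1%g) //= big1 => [|s /andP[Ps /negPf s1]].
    by rewrite gconj1 geps_idem // addr0.
  have := U _ _ P1 Ps; rewrite eq_sym s1 gdelta1 mulr1 gconjE !mulrA => ->.
  by rewrite mul0r.
rewrite mulr_suml (bigD1 1%g) //= big1 => [|s /andP[Ps /negPf s1]].
  by rewrite gconj1 geps_idem // addr0.
have := U _ _ Ps P1; rewrite s1 invg1 gdelta1 mulr1 gconjE -!mulrA => ->.
by rewrite mulr0.
Qed.

Lemma matrix_units i : (i <= n)%N -> units_at i.
Proof.
elim: i => [_ s u|i IHi lt_in].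
  rewrite !prod_T0 !inE => /eqP-> /eqP->; rewrite eqxx.
  by rewrite invg1 gdelta1 !mulr1 geps_idem.
have U := IHi (ltnW lt_in); have [eps_p p_eps] := eps_mulp (ltnW lt_in) U.
have PH := subsetP (prod_T_sub (ltnW lt_in)).
move=> s u; rewrite prod_TS => /mulsgP[{}s x Ps Tx ->] /mulsgP[{}u y Pu Ty ->].
rewrite invMg !gdeltaM; have [xy|neqxy] := eqVneq x y.
  rewrite xy !mulrA -[_ * gdelta y * _]mulrA -gdeltaM mulgV gdelta1 mulr1 U //.
  by rewrite (inj_eq (mulIg y)).
rewrite ifF; last first.
  apply: contraNF neqxy => /eqP eqsx.
  by have [_ ->] := prod_T_inj lt_in Ps Tx Pu Ty eqsx.
have Hu : u^-1%g \in Hs i by rewrite groupV PH.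
have eps_s : eps * gdelta s * p i = eps * gdelta s.
  by rewrite -mulrA (p_comm (ltnW lt_in) (PH s Ps)) mulrA eps_p.
have u_eps : p i * (gdelta u^-1 * eps) = gdelta u^-1 * eps.
  by rewrite mulrA -(p_comm (ltnW lt_in) Hu) -mulrA p_eps.
(* Since [eps] absorbs p_i, which commutes with s and u, p_i can be inserted around x y^-1, where
   [p_orth] applies. *)
transitivity (eps * gdelta s * (p i * gdelta x * gdelta y^-1 * p i)
              * (gdelta u^-1 * eps)).
  by rewrite !mulrA eps_s -!mulrA u_eps.
by rewrite p_orth // mulr0 mul0r.
Qed.

Lemma eps_p i : (i <= n)%N -> eps * p i = eps.
Proof. by move=> le_in; case: (eps_mulp le_in (matrix_units le_in)). Qed.

Lemma p_eps i : (i <= n)%N -> p i * eps = eps.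
Proof. by move=> le_in; case: (eps_mulp le_in (matrix_units le_in)). Qed.

(** For a in eps A eps this is the matrix with a in position (s, u); a = [eps] gives the matrix
    unit. *)
Definition block (a : galg gT) s u : galg gT := gdelta s^-1 * a * gdelta u.

Lemma blockM i a b s u v w : (i <= n)%N -> u \in P i -> v \in P i ->
    a * eps = a -> eps * b = b ->
  block a s u * block b v w = if u == v then block (a * b) s w else 0.
Proof.
move=> le_in Pu Pv aeps epsb.
have -> : block a s u * block b v w
    = gdelta s^-1 * a * (eps * gdelta u * gdelta v^-1 * eps) * b * gdelta w.
  by rewrite /block !mulrA -[_ * a * eps]mulrA aeps -[_ * eps * b]mulrA epsb.
rewrite (matrix_units le_in) //; case: eqP => _; last by rewrite mulr0 !mul0r.
by rewrite /block -[_ * a * eps]mulrA aeps !mulrA.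
Qed.

Lemma p_block i : p i = \sum_(s in P i) block eps s s.
Proof. by []. Qed.

Lemma p_idem i : (i <= n)%N -> p i * p i = p i.
Proof.
move=> le_in; rewrite {1}p_block mulr_suml; apply: eq_bigr => s Ps.
rewrite mulr_sumr (bigD1 s) //= big1 => [|u /andP[Pu /negPf us]].
  by rewrite addr0 (blockM _ _ le_in) ?eqxx ?geps_idem.
by rewrite (blockM _ _ le_in) ?geps_idem // eq_sym us.
Qed.

(** * Membership in Q(H_i)e_i and centrality of p_i *)

Lemma eps_QG i : (i <= n)%N -> eps \in QG (Hs i).
Proof. by move=> le_in; apply: QGS (chain_base_sub le_in) (geps_QG _). Qed.

Lemma p_QG i : (i <= n)%N -> p i \in QG (Hs i).
Proof.
move=> le_in; apply: memv_suml => s Ps; apply: gconj_QG (eps_QG le_in).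
exact: (subsetP (prod_T_sub le_in)).
Qed.

Lemma chain_QGeP i x : (i <= n)%N ->
  x \in QGe (Hs i) (e i) <-> x \in QG (Hs i) /\ x * p i = x.
Proof.
move=> le_in; have [d nzd ->] := ch_eE le_in.
exact: QGeP nzd (p_QG le_in) (p_idem le_in).
Qed.

Lemma QG_comm (X : {group gT}) a b :
    {in X, forall x, gdelta x * a = a * gdelta x} ->
  b \in QG X -> b * a = a * b.
Proof.
move=> aX /QGP b0; rewrite [b]galg_sumE mulr_suml mulr_sumr; apply: eq_bigr => x _.
have [Xx|/b0->] := boolP (x \in X); last by rewrite scale0r mul0r mulr0.
by rewrite -scalerAl -scalerAr aX.
Qed.

Lemma p_central i a : (i <= n)%N -> a \in QG (Hs i) -> a * p i = p i * a.
Proof. by move=> le_in; apply: QG_comm => x; apply: p_comm. Qed.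

Lemma p_delta i x y : (i < n)%N -> x \in T i -> y \in T i ->
  p i * gdelta x * gdelta y^-1 * p i = if x == y then p i else 0.
Proof.
move=> lt_in Tx Ty; have [->|/p_orth->//] := eqVneq x y.
by rewrite -[_ * gdelta y * _]mulrA -gdeltaM mulgV mulr1 p_idem // ltnW.
Qed.

Lemma p_subp i : (i < n)%N -> p i.+1 * p i = p i.
Proof.
move=> lt_in; rewrite [p i]p_block mulr_sumr; apply: eq_bigr => s Ps.
have Hs_s : s^-1%g \in Hs i.+1.
  by rewrite groupV (subsetP (sHs lt_in)) // (subsetP (prod_T_sub (ltnW lt_in))).
by rewrite /block !mulrA -(p_comm lt_in) // -[_ * p _ * eps]mulrA p_eps.
Qed.

(** * Nested matrices: scalars, matrix units and entries *)

Lemma mem_ch_T i (l : 'I_(k i)) : t i l \in T i.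
Proof. exact: imset_f. Qed.

Lemma ch_t_inj i (l m : 'I_(k i)) : (i < n)%N -> t i l = t i m -> l = m.
Proof.
move=> lt_in; apply: (@imset_injP _ _ (fun l : 'I_(k i) => t i l) 'I_(k i) _) => //.
rewrite card_ord -[#|_|]/#|T i|.
by rewrite (card_transversalE (ch_T_trans lt_in)).
Qed.

Lemma ch_thetaE i : (i < n)%N -> exists2 d, d != 0 & forall b l m,
  theta i b l m = d *: (p i * gdelta (t i l) * b * gdelta (t i m)^-1 * p i).
Proof.
move=> lt_in; have [d nzd De] := ch_eE (ltnW lt_in); exists (d * d).
  by rewrite mulf_neq0.
by move=> b l m; rewrite mxE De -!scalerAl -scalerAr scalerA.
Qed.

Lemma eQ_lambda : exists2 d, d != 0 & eQ lambda = d *: eps.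
Proof.
have [|r nzr ->] := eQ_trace_elt (lin_charW lin).
  by rewrite lin_char1 // oner_eq0.
have [q nzq ->] := trace_elt_geps lin; exists (r * q); rewrite ?scalerA //.
by rewrite mulf_neq0.
Qed.

(** Scalars lift to scalars. In general r differs from q, because [ch_theta] multiplies by the
    square of the scalar in e_i = d p_i at each level. *)
Lemma nested_diag_eps q i : (i <= n)%N ->
  exists r, nested_diag lambda Hs t i (q *: eps) (r *: p i).
Proof.
elim: i => [_|i IHi lt_in].
  by exists q; rewrite /= /p prod_T0 big_set1 gconj1.
have [r IHr] := IHi (ltnW lt_in); have [d nzd Dtheta] := ch_thetaE lt_in.
exists (r / d); split.
  by apply/chain_QGeP => //; rewrite memvZ ?p_QG // -scalerAl p_idem.
exists (r *: p i) => //; apply/matrixP=> l m; rewrite Dtheta [RHS]mxE.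
rewrite -scalerAr -!scalerAl scalerA mulrC divfK //.
have Hl : t i l \in Hs i.+1 by rewrite (subsetP (ch_T_sub lt_in)) ?mem_ch_T.
have Hm : (t i m)^-1%g \in Hs i.+1.
  by rewrite groupV (subsetP (ch_T_sub lt_in)) ?mem_ch_T.
rewrite -[_ * p _ * gdelta _]mulrA -(p_comm lt_in) // !mulrA.
rewrite -[_ * p i.+1 * p i]mulrA p_subp // p_delta ?mem_ch_T //.
have [->|neqlm] := eqVneq l m; first by rewrite eqxx.
rewrite ifF ?scaler0 //; apply: contraNF neqlm => /eqP tlm.
by rewrite (ch_t_inj lt_in tlm).
Qed.

(** As t_(i,1) = 1, the first diagonal entry at each level is a nonzero multiple of p_i x p_i, and
    [eps] absorbs p_i. *)
Lemma nested_diag_corner i b x : (i <= n)%N -> nested_diag lambda Hs t i b x ->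
  exists2 r, r != 0 & eps * x * eps = r *: (eps * b * eps).
Proof.
elim: i x => [|i IHi] x; first by move=> _ ->; exists 1; rewrite ?scale1r ?oner_eq0.
move=> lt_in [_ [y /(IHi _ (ltnW lt_in))[r nzr Dy] Dx]].
have [d nzd Dtheta] := ch_thetaE lt_in.
have k_gt0 : (0 < k i)%N by apply: (@indexg_gt0 _ _ (gcent_group _ _)).
have t1 : t i 0 = 1%g by case: (trans lt_in).
have := congr1 (fun M : 'M_(k i) => M (Ordinal k_gt0) (Ordinal k_gt0)) Dx.
rewrite Dtheta [in RHS]mxE eqxx mulr1n t1 invg1 gdelta1 !mulr1 => Dy'.
exists (d^-1 * r); first by rewrite mulf_neq0 ?invr_eq0.
rewrite -scalerA -Dy -Dy' -scalerAr -scalerAl scalerA mulVf // scale1r !mulrA.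
by rewrite eps_p ?(ltnW lt_in) // -!mulrA p_eps // ltnW.
Qed.

Lemma ch_F_eps q : ch_F lambda Hs t n (q *: eps).
Proof.
have [d nzd De] := eQ_lambda; split.
  rewrite /ch_E De; apply/(QGeP _ nzd); rewrite ?geps_QG ?geps_idem //.
  by rewrite memvZ ?geps_QG // -scalerAl geps_idem.
have [r Dr] := nested_diag_eps q (leqnn n); exists (r *: p n) => //; split.
  by apply/chain_QGeP => //; rewrite memvZ ?p_QG // -scalerAl p_idem.
move=> y /(chain_QGeP _ (leqnn n))[Hy _].
by rewrite -scalerAr -scalerAl p_central.
Qed.

(** By [p_delta], [ch_theta] sends the unit at (s x, u y) to a matrix whose only nonzero entry, in
    the position of x and y, is a multiple of the unit at (s, u). At i = n this puts the matrix
    units in B. *)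
Lemma nested_block i q s u : (i <= n)%N -> s \in P i -> u \in P i ->
  nested_mx lambda Hs t (ch_F lambda Hs t n) i (q *: block eps s u).
Proof.
elim: i q s u => [|i IHi] q s u.
  rewrite !prod_T0 !inE => _ /eqP-> /eqP->.
  by rewrite /block invg1 gdelta1 mul1r mulr1; apply: ch_F_eps.
move=> lt_in Ps Pu; have le_in := ltnW lt_in.
split.
  apply/chain_QGeP => //; have PH := subsetP (prod_T_sub lt_in).
  have Hu := PH u Pu; have Hs_s := PH s Ps; split.
    by rewrite memvZ // !QGM ?gdelta_QG ?groupV ?eps_QG.
  rewrite -scalerAl /block -[_ * _ * p _]mulrA (p_comm lt_in) // !mulrA.
  by rewrite -[_ * eps * p _]mulrA eps_p.
move=> l m; have [d nzd ->] := ch_thetaE lt_in.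
move: Ps Pu; rewrite prod_TS => /mulsgP[{}s x Ps Tx ->] /mulsgP[{}u y Pu Ty ->].
have PH := subsetP (prod_T_sub le_in).
have Hu := PH u Pu; have Hs_s : s^-1%g \in Hs i by rewrite groupV PH.
have pbp : p i * block eps s u * p i = block eps s u.
  rewrite -!mulrA (p_comm le_in) // !mulrA -(p_comm le_in) //.
  by rewrite -[_ * p i * eps]mulrA p_eps // -[_ * eps * p i]mulrA eps_p.
have -> : p i * gdelta (t i l) * (q *: block eps (s * x)%g (u * y)%g)
       * gdelta (t i m)^-1 * p i
    = q *: ((p i * gdelta (t i l) * gdelta x^-1 * p i) * block eps s u
            * (p i * gdelta y * gdelta (t i m)^-1 * p i)).
  rewrite -scalerAr -!scalerAl; congr (_ *: _).
  transitivity (p i * gdelta (t i l) * gdelta x^-1 * (p i * block eps s u * p i)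
                * (gdelta y * gdelta (t i m)^-1 * p i)); last by rewrite !mulrA.
  by rewrite pbp /block invMg !gdeltaM !mulrA.
rewrite !p_delta ?mem_ch_T // scalerA.
have zero : nested_mx lambda Hs t (ch_F lambda Hs t n) i 0.
  by rewrite -(scale0r (block eps s u)); apply: IHi.
case: eqP => _; last by rewrite !mul0r scaler0.
by case: eqP => _; rewrite ?pbp ?mulr0 ?scaler0 //; apply: IHi.
Qed.

(** The product extracts the entry at (s, u), up to a rational factor. Entries lie in F, so they act
    on [eps] as central elements of A; the factors are absorbed into x. *)
Lemma nested_corner i b s u : (i <= n)%N -> s \in P i -> u \in P i ->
    nested_mx lambda Hs t (ch_F lambda Hs t n) i b ->
  exists2 x, ch_FF lambda Hs n x &
    eps * gdelta s * b * gdelta u^-1 * eps = x * eps.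
Proof.
elim: i b s u => [|i IHi] b s u.
  rewrite !prod_T0 !inE => _ /eqP-> /eqP-> [_ [x Dbx [Ax xC]]].
  have [r nzr Dr] := nested_diag_corner (leqnn n) Dbx.
  have Aeps : ch_A lambda Hs n eps by apply/chain_QGeP; rewrite ?eps_QG ?eps_p.
  exists (r^-1 *: x).
    split=> [|y Ay]; first by apply: rpredZ.
    by rewrite -scalerAl -scalerAr xC.
  rewrite invg1 gdelta1 !mulr1 -scalerAl -[in RHS](geps_idem lin) mulrA.
  by rewrite xC // Dr scalerA mulVf // scale1r.
move=> lt_in Ps Pu [_ nb]; have le_in := ltnW lt_in.
move: Ps Pu; rewrite prod_TS => /mulsgP[{}s x Ps Tx ->] /mulsgP[{}u y Pu Ty ->].
have PH := subsetP (prod_T_sub le_in).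
have Hs_s := PH s Ps; have Hu : u^-1%g \in Hs i by rewrite groupV PH.
have [l _ Dx] := imsetP Tx; have [m _ Dy] := imsetP Ty.
have [c FFc Dc] := IHi _ _ _ le_in Ps Pu (nb l m).
have [d nzd Dtheta] := ch_thetaE lt_in.
exists (d^-1 *: c).
  case: FFc => Ac cC; split=> [|v Av]; first by apply: rpredZ.
  by rewrite -scalerAl -scalerAr cC.
rewrite -scalerAl -Dc Dtheta -!(scalerAr, scalerAl) scalerA mulVf // scale1r.
rewrite -Dx -Dy invMg !gdeltaM.
have eps_s : eps * gdelta s * p i = eps * gdelta s.
  by rewrite -mulrA (p_comm le_in Hs_s) mulrA eps_p.
have u_eps : p i * (gdelta u^-1 * eps) = gdelta u^-1 * eps.
  by rewrite mulrA -(p_comm le_in Hu) -mulrA p_eps.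
rewrite !mulrA eps_s -!mulrA u_eps.
by [].
Qed.

Lemma nested_mx_QGe i b : (i <= n)%N ->
  nested_mx lambda Hs t (ch_F lambda Hs t n) i b -> b \in QGe (Hs i) (e i).
Proof.
case: i => [|i] le_in; last by case.
have [d nzd De] := eQ_lambda; case; rewrite /ch_E De => Eb _.
have [Hb beps] := (QGeP b nzd (geps_QG lambda) (geps_idem lin)).1 Eb.
apply/chain_QGeP => //; split; first by rewrite Hs0.
by rewrite /p prod_T0 big_set1 gconj1.
Qed.

(** * Transfer of primitive idempotents from Cen(B) to A *)

Section Lift.

Hypothesis e_idem : e n * e n = e n.

Lemma ch_e_p : e n = p n.
Proof.
have [d nzd De] := ch_eE (leqnn n); move: e_idem.
rewrite De -scalerAl -scalerAr p_idem // => /(scalerI nzd) dp.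
suff -> : d = 1 by rewrite scale1r.
(* Multiplying d p_n = p_n by the nonzero element [eps] gives d = 1. *)
have : (d - 1) *: eps = 0.
  by rewrite -(eps_p (leqnn n)) scalerAr scalerBl scale1r dp subrr mulr0.
by move/eqP; rewrite scaler_eq0 (negPf (geps_neq0 lin)) orbF subr_eq0 => /eqP.
Qed.

Local Notation A := (ch_A lambda Hs n).
Local Notation CenB := (ch_CenB lambda Hs t n).

Lemma ch_AP x : A x <-> x \in QG (Hs n) /\ x * p n = x.
Proof. exact: chain_QGeP. Qed.

Lemma ch_AM x y : A x -> A y -> A (x * y).
Proof.
move=> /ch_AP[Hx _] /ch_AP[Hy yp]; apply/ch_AP.
by rewrite QGM // -mulrA yp.
Qed.

Lemma ch_A_gconj x s : s \in Hs n -> A x -> A (gconj x s).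
Proof.
move=> Hs_s /ch_AP[Hx xp]; apply/ch_AP; split; first exact: gconj_QG.
by rewrite !gconjE -mulrA p_comm // !mulrA -[_ * x * _]mulrA xp.
Qed.

Lemma ch_A_eps : A eps.
Proof. by apply/ch_AP; rewrite eps_QG ?eps_p. Qed.

(** For a in eps A eps this is diag(a, ..., a) with respect to the matrix units; it is inverse to
    the map f |-> f eps on Cen(B). *)
Definition lift a : galg gT := \sum_(s in P n) gconj a s.

Lemma liftE a : lift a = \sum_(s in P n) block a s s.
Proof. by []. Qed.

Lemma liftD a b : lift (a + b) = lift a + lift b.
Proof. by rewrite /lift -big_split; apply: eq_bigr => s _; apply: gconjD. Qed.

Lemma liftM a b : a * eps = a -> eps * b = b -> lift a * lift b = lift (a * b).
Proof.
move=> aeps epsb; rewrite /lift mulr_suml; apply: eq_bigr => s Ps.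
rewrite mulr_sumr (bigD1 s) //= big1 => [|u /andP[Pu /negPf us]].
  by rewrite addr0 [LHS](blockM _ _ (leqnn n)) ?eqxx.
by rewrite [LHS](blockM _ _ (leqnn n)) // eq_sym us.
Qed.

Lemma lift_eps a : eps * a = a -> a * eps = a -> lift a * eps = a.
Proof.
move=> epsa aeps; have P1 := prod_T_1 (leqnn n).
have D : block eps 1%g 1%g = eps.
  by rewrite /block invg1 gdelta1 mul1r mulr1.
rewrite -[in LHS]D liftE mulr_suml (bigD1 1%g) //= big1 ?addr0 => [|s /andP[Ps /negPf s1]].
  by rewrite (blockM _ _ (leqnn n)) ?geps_idem // eqxx /block invg1 gdelta1 mul1r mulr1.
by rewrite (blockM _ _ (leqnn n)) ?geps_idem // s1.
Qed.

(** The two products are compared entry by entry: by [nested_corner] an entry of b is x eps with x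
    central in A, so it commutes with a. *)
Lemma lift_CenB a : A a -> eps * a = a -> a * eps = a -> CenB (lift a).
Proof.
move=> Aa epsa aeps; split.
  by apply: rpred_sum => s Ps; apply: ch_A_gconj (subsetP (prod_T_sub _) s Ps) _.
move=> b Bb; have /ch_AP[Hb bp] := nested_mx_QGe (leqnn n) Bb.
have pb : p n * b = b by rewrite -p_central.
transitivity (\sum_(s in P n) \sum_(u in P n) block a s s * (b * block eps u u)).
  rewrite -[in LHS]bp liftE mulr_suml p_block; apply: eq_bigr => s _.
  by rewrite !mulr_sumr.
rewrite -[in RHS]pb p_block !mulr_suml; apply: eq_bigr => s Ps.
rewrite liftE mulr_sumr; apply: eq_bigr => u Pu.
have [x [_ xC] Dx] := nested_corner (leqnn n) Ps Pu Bb.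
transitivity (gdelta s^-1 * a * (eps * gdelta s * b * gdelta u^-1 * eps) * gdelta u).
  by rewrite /block !mulrA -[_ * a * eps]mulrA aeps.
transitivity (gdelta s^-1 * (eps * gdelta s * b * gdelta u^-1 * eps) * a * gdelta u).
  rewrite Dx; congr (_ * _); rewrite -!mulrA; congr (_ * _).
  by rewrite epsa mulrA -(xC _ Aa) -mulrA aeps.
by rewrite /block !mulrA -[_ * eps * a]mulrA epsa.
Qed.

(** The elements [eps] s and s^-1 [eps] are the matrix units at (1, s) and (s, 1), which belong to
    B. *)
Lemma CenB_eps f s : CenB f -> s \in P n ->
  f * (eps * gdelta s) = eps * gdelta s * f /\
  f * (gdelta s^-1 * eps) = gdelta s^-1 * eps * f.
Proof.
move=> [_ fC] Ps; have P1 := prod_T_1 (leqnn n); split.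
  have := fC _ (nested_block 1 (leqnn n) P1 Ps).
  by rewrite scale1r /block invg1 gdelta1 mul1r.
have := fC _ (nested_block 1 (leqnn n) Ps P1).
by rewrite scale1r /block gdelta1 mulr1.
Qed.

(** Expand f = f p_n and move f past each s^-1 [eps]. *)
Lemma lift_mul_eps f : CenB f -> lift (f * eps) = f.
Proof.
move=> Cf; have [Af _] := Cf; have /ch_AP[_ fp] := Af.
rewrite -[RHS]fp mulr_sumr; apply: eq_bigr => s Ps.
have [fs fs'] := CenB_eps Cf Ps.
have [f1 _] := CenB_eps Cf (prod_T_1 (leqnn n)).
rewrite gdelta1 mulr1 in f1.
rewrite !gconjE.
rewrite -[X in gdelta s^-1 * (f * X)](geps_idem lin).
rewrite [f * _]mulrA f1.
rewrite !mulrA -fs'.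
by rewrite -!mulrA [eps * (eps * _)]mulrA geps_idem.
Qed.

Lemma primitive_corner f :
  primitive_idempotent CenB f -> primitive_idempotent A (f * eps).
Proof.
case=> Cf nzf ff prim; have [Af _] := Cf.
have [f_eps _] := CenB_eps Cf (prod_T_1 (leqnn n)).
rewrite gdelta1 mulr1 in f_eps.
have fe_e : f * eps * eps = f * eps by rewrite -mulrA geps_idem.
have e_fe : eps * (f * eps) = f * eps by rewrite f_eps mulrA geps_idem.
split; first exact: ch_AM Af ch_A_eps.
- apply: contraNneq nzf => fe0; rewrite -[f]lift_mul_eps // fe0.
  by rewrite liftE big1 // => s _; rewrite /block mulr0 mul0r.
- by rewrite mulrA -[f * eps * f]mulrA -f_eps !mulrA ff.
move=> a b [Aa Ab aa bb [ab ba]] nza nzb Dfe.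
(* Orthogonal summands of f eps are fixed by f eps on both sides, hence lie in eps A eps, where
   [lift] is multiplicative and injective. *)
have corner x y : x * x = x -> x * y = 0 -> y * x = 0 -> f * eps = x + y ->
    eps * x = x /\ x * eps = x.
  move=> xx xy yx Dxy.
  have Dl : f * eps * x = x by rewrite Dxy mulrDl xx yx addr0.
  have Dr : x * (f * eps) = x by rewrite Dxy mulrDr xx xy addr0.
  by split; [rewrite -[x in LHS]Dl mulrA e_fe | rewrite -[x in LHS]Dr -mulrA fe_e].
have [ea ae] := corner a b aa ab ba Dfe.
have [eb be] : eps * b = b /\ b * eps = b by apply: (corner b a); rewrite // addrC.
have lift0 : lift 0 = 0.
  by rewrite liftE big1 // => s _; rewrite /block mulr0 mul0r.
apply: (prim (lift a) (lift b)).
- split; rewrite ?liftM ?aa ?bb ?ab ?ba //; first exact: lift_CenB.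
  exact: lift_CenB.
- by apply: contraNneq nza => la0; rewrite -[a]lift_eps // la0 mul0r.
- by apply: contraNneq nzb => lb0; rewrite -[b]lift_eps // lb0 mul0r.
by rewrite -liftD -Dfe lift_mul_eps.
Qed.

Lemma primitive_gconj x s : s \in Hs n ->
  primitive_idempotent A x -> primitive_idempotent A (gconj x s).
Proof.
move=> Hs_s [Ax nzx xx prim].
have Hs_s' : s^-1%g \in Hs n by rewrite groupV.
have conj0 (y : galg gT) u : gconj y u = 0 -> y = 0.
  move=> y0; rewrite -[y]gconj1 -(mulgV u) gconj_mul y0.
  by rewrite gconjE mulr0 mul0r.
split; first exact: ch_A_gconj.
- by apply: contraNneq nzx => /conj0->.
- by rewrite -gconjM xx.
move=> a b [Aa Ab aa bb [ab ba]] nza nzb Dx.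
apply: (prim (gconj a s^-1) (gconj b s^-1)).
- split; rewrite -?gconjM ?aa ?bb ?ab ?ba //; try exact: ch_A_gconj.
  by rewrite !gconjE mulr0 mul0r.
- by apply: contraNneq nza => /conj0->.
- by apply: contraNneq nzb => /conj0->.
by rewrite -gconjD -Dx -gconj_mul mulgV gconj1.
Qed.

Lemma complete_lift (I : finType) (f : I -> galg gT) :
  complete_orthogonal_primitive CenB (e n) predT f ->
  complete_orthogonal_primitive A (e n)
    (fun q : gT * I => q.1 \in P n) (fun q => gconj (f q.2 * eps) q.1).
Proof.
case=> prim_f orth_f sum_f.
have Cf i : CenB (f i) by case: (prim_f i isT).
have f_eps i : f i * eps = eps * f i.
  have [] := CenB_eps (Cf i) (prod_T_1 (leqnn n)).
  by rewrite gdelta1 mulr1.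
have fe_e i : f i * eps * eps = f i * eps by rewrite -mulrA geps_idem.
have e_fe i : eps * (f i * eps) = f i * eps by rewrite f_eps mulrA geps_idem.
split=> [[s i] /= Ps | [s i] [u j] /= Ps Pu neq | ].
- apply: primitive_gconj; first exact: (subsetP (prod_T_sub _)).
  exact/primitive_corner/prim_f.
(* Different s give orthogonal blocks; for equal s the indices i and j differ, and f_i f_j = 0. *)
- rewrite [LHS](blockM _ _ (leqnn n)) //; case: eqP => // su.
  have neqij : i != j by apply: contraNneq neq => ->; rewrite su.
  by rewrite f_eps -mulrA [f i * _]mulrA orth_f // mul0r mulr0 /block mulr0 mul0r.
transitivity (\sum_(s in P n) \sum_i gconj (f i * eps) s).
  by rewrite pair_big; apply: eq_bigl => -[s i] /=; rewrite andbT.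
(* For fixed s the f_i sum to e_n = p_n, which fixes [eps]; the conjugates of [eps] then sum to
   p_n. *)
rewrite ch_e_p; apply: eq_bigr => s Ps.
rewrite -gconj_sum -mulr_suml sum_f ch_e_p p_eps //.
Qed.

End Lift.

End Chain.

(** * The complete set of idempotents in QGe *)

Lemma eq_complete_orthogonal_primitive (gT : finGroupType) (R : galg gT -> Prop)
    (e : galg gT) (I : finType) (P : pred I) (f g : I -> galg gT) :
    (forall i, P i -> f i = g i) ->
  complete_orthogonal_primitive R e P f ->
  complete_orthogonal_primitive R e P g.
Proof.
move=> fg [prim orth sum]; split=> [i Pi | i j Pi Pj | ].
- by rewrite -fg //; apply: prim.
- by rewrite -!fg //; apply: orth.
by rewrite -sum; apply: eq_bigr => i /fg->.
Qed.

Theorem theorem3p4 (gT : finGroupType) (G H K : {group gT})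
    (lambda : 'CF(H)) (n : nat) (Hs : nat -> {group gT})
    (t : nat -> nat -> gT)
    (sigma : 'I_(ch_deg lambda Hs n) -> galg gT -> galg gT) (w : galg gT)
    (z zV alpha_ : 'I_(ch_deg lambda Hs n) -> galg gT) (alphaV : galg gT) :
  lambda \is a linear_char -> cfker lambda = K ->
  gen_strong_Shoda_pair G K lambda ->
  strong_inductive_chain G lambda n Hs ->
  right_transversals lambda Hs t n ->
  let A : galg gT -> Prop := fun x => x \in QGe G (eQ ('Ind[G] lambda)) in
  let e := eQ ('Ind[G] lambda) in
  let EE := ch_EE lambda Hs t n in
  let FF := ch_FF lambda Hs n in
  let CenB := ch_CenB lambda Hs t n in
  has_Schur_index A e 1 ->
  Gal_enum EE FF sigma ->
  (forall i : 'I_(ch_deg lambda Hs n), i = 0%N :> nat ->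
     forall x, EE x -> sigma i x = x) ->
  normal_element EE FF sigma w ->
  (forall i, inverse_in CenB e (z i) (zV i)) ->
  left_basis EE CenB z ->
  (forall i, EE (alpha_ i)) ->
  \sum_i alpha_ i * sigma i w = \sum_i sigma i w ->
  (forall j : 'I_(ch_deg lambda Hs n), j <> 0%N :> nat ->
     \sum_i alpha_ i * sigma i (sigma j w) = w - sigma j w) ->
  let alpha := \sum_i alpha_ i * z i in
  inverse_in CenB e alpha alphaV ->
  let Ehat := (ch_deg lambda Hs n)%:R^-1 *: \sum_i z i in
  complete_orthogonal_primitive CenB e predT
    (fun i => zV i * alphaV * Ehat * alpha * z i) ->
  complete_orthogonal_primitive A e
    (fun p : gT * 'I_(ch_deg lambda Hs n) => p.1 \in prod_T lambda Hs t n)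
    (fun p => gdelta p.1^-1 * zV p.2 * alphaV * Ehat * geps H K * alpha
              * z p.2 * gdelta p.1).
Proof.
move=> lin kerK _ [Hs0 HsG chain] trans A e EE FF CenB [D [m [phi [_ phiM _ _ _]]]].
move=> _ _ _ zP _ _ _ _ alpha alphaP Ehat.
have DK : K = [group of cfker lambda] by apply: val_inj; rewrite /= kerK.
have sHs i : (i < n)%N -> Hs i \subset Hs i.+1 by case/chain.
have orth i : (i < n)%N -> {in Hs i.+1 &, forall x y,
     gconj (ch_e lambda Hs i) x != gconj (ch_e lambda Hs i) y ->
     gconj (ch_e lambda Hs i) x * gconj (ch_e lambda Hs i) y = 0}.
  by case/chain.
(* The element e is the image of the identity matrix under the isomorphism [phi]. *)
have e_idem : ch_e lambda Hs n * ch_e lambda Hs n = ch_e lambda Hs n.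
  case: phiM => _ phiM phi1; rewrite /ch_e HsG -[eQ _]/e -phi1 -phiM.
  by rewrite mulr1.
rewrite /A /e -HsG.
move/(complete_lift lin Hs0 sHs orth trans e_idem).
apply: eq_complete_orthogonal_primitive => -[s i] Ps; rewrite gconjE -DK /=.
have P1 := prod_T_1 trans (leqnn n).
(* The family of [complete_lift] has epsilon(H, K) after z_i, whereas here it stands before alpha.
   It commutes with alpha and z_i, which lie in Cen(B). *)
have CenB_geps c : CenB c -> geps H K * c = c * geps H K.
  move=> Cc; have := CenB_eps lin Hs0 sHs orth trans Cc P1.
  by rewrite -DK gdelta1 mulr1 => -[].
have [Calpha _ _ _] := alphaP; have [Cz _ _ _] := zP i.
rewrite -!mulrA; do 4 congr (_ * _).
rewrite [RHS]mulrA (CenB_geps _ Calpha) -mulrA; congr (_ * _).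
by rewrite [RHS]mulrA (CenB_geps _ Cz) mulrA.
Qed.
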